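(* There exists a constant $b_1>0$, independent of $\delta$ and $c$, such that $$\sup_{c\in P}|\bar H_\delta(c)-\bar H(c)|\le b_1\sqrt h\qquad\text{as }\delta=(h,\tau)\to0\ \text{ under } 0<\lambda_0\le\lambda=\tau/h<\lambda_1 .$$
   Context: Lagrangian: $\mathbb{T}=\mathbb{R}/\mathbb{Z}$, $\mathbb{T}^d=\mathbb{R}^d/\mathbb{Z}^d$; functions on tori are identified with $1$-periodic functions. $|x|_\infty=\max_j|x^j|$, $|\cdot|$ is the Euclidean norm. $L=L(x,t,\zeta):\mathbb{T}^d\times\mathbb{T}\times\mathbb{R}^d\to\mathbb{R}$ is $C^2$; $L_{\zeta\zeta}$ is positive definite everywhere; for each $a\ge0$ there is $b(a)\in\mathbb{R}$ with $L\ge a|\zeta|+b(a)$ everywhere; there is $\alpha>0$ with $|L_{x^j}|\le\alpha(1+|L|)$ everywhere ($j=1,\dots,d$). $H(x,t,p)=\sup_{\zeta\in\mathbb{R}^d}(p\cdot\zeta-L(x,t,\zeta))$, $L^{(c)}(x,t,\zeta)=L(x,t,\zeta)-c\cdot\zeta$. $P\subset\mathbb{R}^d$ is a fixed compact convex set and $r>0$ is a fixed number. $\bar H(c)$ (exact effective Hamiltonian) is the unique real number for which $v_t+H(x,t,c+v_x)=\bar H(c)$ in $\mathbb{T}^d\times\mathbb{T}$ admits a viscosity solution. Grid: $\delta=(h,\tau)$, $h=(2N)^{-1}$, $\tau=(2K)^{-1}$ with $N,K\in\mathbb{N}$, $\lambda=\tau/h$; $x_m=hm$ ($m\in\mathbb{Z}^d$),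 $t_k=\tau k$ ($k\in\mathbb{Z}$). $G_{\rm even}$ (resp. $G_{\rm odd}$) is the set of $x_m$ with $m^1+\dots+m^d$ even (resp. odd). $\mathcal{G}_\delta=\bigcup_{k}\{(G_{\rm even}\times\{t_{2k}\})\cup(G_{\rm odd}\times\{t_{2k+1}\})\}$, $\tilde{\mathcal{G}}_\delta=\bigcup_{k}\{(G_{\rm odd}\times\{t_{2k}\})\cup(G_{\rm even}\times\{t_{2k+1}\})\}$. $e_1,\dots,e_d$ is the standard basis, $B=\{\pm e_1,\dots,\pm e_d\}$. For $v:\tilde{\mathcal{G}}_\delta\to\mathbb{R}$ write $v^k_m=v(x_m,t_k)$ and, for $(x_m,t_k)\in\mathcal{G}_\delta$, $(D_{x^j}v)^k_m=\frac{v^k_{m+e_j}-v^k_{m-e_j}}{2h}$, $D_xv=(D_{x^1}v,\dots,D_{x^d}v)$, $(D_tv)^{k+1}_m=\frac1\tau\big(v^{k+1}_m-\frac1{2d}\sum_{\omega\in B}v^k_{m+\omega}\big)$. Solution map: $X_\delta$ is the set of $w:G_{\rm odd}\to\mathbb{R}$, $1$-periodic in each coordinate, with $|D_xw|_\infty\le r$ on $G_{\rm even}$. For $v^0\in X_\delta$, $c\in P$, $\varphi^k_\delta(v^0;c)=v(\cdot,t_k)$, where $(D_tv)^{k+1}_m+H(x_m,t_k,c+(D_xv)^k_m)=0$, $v(\cdot,0)=v^0$; $\varphi_\delta=\varphi^{2K}_\delta$. $\bar H_\delta(c)$ is the unique real number for which some $\bar v^0\in X_\delta$ satisfies $\varphi_\delta(\bar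 v^0;c)+\bar H_\delta(c)=\bar v^0$. Standing assumption: $r$ is large enough (depending only on $L$, $P$) and the $\delta$ considered are small enough, with $0<\lambda_0\le\lambda<\lambda_1$ for a constant $\lambda_1=\lambda_1(r,P)>0$ and a fixed $\lambda_0\in(0,\lambda_1)$, so that for every $c\in P$ and $v^0\in X_\delta$: $\varphi_\delta(\cdot;c)$ maps $X_\delta$ into itself; $|H_p(x_m,t_k,c+(D_xv)^k_m)|_\infty\le(d\lambda_1)^{-1}<(d\lambda)^{-1}$ for all $k\ge0$, $m$; and $v^{l+1}_n=\inf_\xi E\big[\sum_{0<k\le l+1}L^{(c)}(\gamma^k,t_{k-1},\xi^k_{m(\gamma^k)})\tau+v^0_{m(\gamma^0)}\big]$, where $m(x)$ is the index of a grid point $x$, the infimum is over controls $\xi$ with values in $[-(d\lambda)^{-1},(d\lambda)^{-1}]^d$, $\gamma$ is the backward random walk with $\gamma^{l+1}=x_n$ jumping from $(x_m,t_{k+1})$ to $(x_m+h\omega,t_k)$ with probability $\frac1{2d}-\frac\lambda2\omega\cdot\xi^{k+1}_m$ ($\omega\in B$), and the minimizing control is $\xi^{*\,k+1}_m=H_p(x_m,t_k,c+(D_xv)^k_m)$. ''As $\delta\to0$'' means: for all sufficiently small such $\delta$. *)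

(* Defs.v *)
From HB Require Import structures.
From mathcomp Require Import all_boot all_order all_algebra.
From mathcomp Require Import all_classical all_reals all_analysis.

Set Implicit Arguments.
Unset Strict Implicit.
Unset Printing Implicit Defensive.

Import Order.TTheory GRing.Theory Num.Theory.
Import numFieldNormedType.Exports.

Local Open Scope classical_set_scope.
Local Open Scope ring_scope.

(* Functions on the torus T^d x T are 1-periodic functions on R^d x R, with
   R^d = 'rV[R]_d.  The library norm `|x| on 'rV[R]_d is the max norm, so it
   stands for |x|_oo throughout; the Euclidean norm is [enorm]. *)

Section Calculus.
Context {R : realType}.

Definition C1 (V : normedModType R) (f : V -> R) : Prop :=
  forall v : V, (forall x, derivable f x v) /\ continuous (fun x => 'D_v f x).

Definition C2 (V : normedModType R) (f : V -> R) : Prop :=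
  C1 f /\ forall v : V, C1 (fun x => 'D_v f x).

Context {d : nat}.
Implicit Types x p : 'rV[R]_d.

Definition dot x p : R := \sum_(j < d) x 0 j * p 0 j.

Definition enorm x : R := Num.sqrt (dot x x).

Definition ebasis (j : 'I_d) : 'rV[R]_d := delta_mx 0 j.

Definition gradient (f : 'rV[R]_d -> R) x : 'rV[R]_d :=
  \row_j 'D_(ebasis j) f x.

Definition hessian (f : 'rV[R]_d -> R) x : 'M[R]_d :=
  \matrix_(i, j) 'D_(ebasis i) (fun y => 'D_(ebasis j) f y) x.

Definition positive_definite (A : 'M[R]_d) : Prop :=
  forall y : 'rV[R]_d, y != 0 -> 0 < (y *m A *m y^T) 0 0.

End Calculus.

Section Lagrangian.
Context {R : realType} {d : nat}.
Implicit Types (L : 'rV[R]_d * R * 'rV[R]_d -> R) (x c p zeta : 'rV[R]_d).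
Implicit Types (t a : R).

Record lagrangian L : Prop := Lagrangian {
  lagrangian_periodic : forall (z : 'rV[int]_d) (s : int) x t zeta,
    L (x + map_mx intr z, t + s%:~R, zeta) = L (x, t, zeta) ;
  lagrangian_C2 : C2 L ;
  lagrangian_convex : forall x t zeta,
    positive_definite (hessian (fun eta => L (x, t, eta)) zeta) ;
  lagrangian_superlinear : forall a, 0 <= a ->
    exists b : R, forall x t zeta, a * enorm zeta + b <= L (x, t, zeta) ;
  lagrangian_growth : exists2 alpha : R, 0 < alpha &
    forall x t zeta (j : 'I_d),
      `|'D_(ebasis j) (fun y => L (y, t, zeta)) x|
        <= alpha * (1 + `|L (x, t, zeta)|) }.

(* Superlinearity makes the supremum finite, so [sup] in R is the right one. *)
Definition hamiltonian L x t p : R :=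
  sup [set dot p zeta - L (x, t, zeta) | zeta in [set: 'rV[R]_d]].

Definition hamiltonian_p L x t p : 'rV[R]_d := gradient (hamiltonian L x t) p.

Definition tilted L c x t zeta : R := L (x, t, zeta) - dot c zeta.

Definition periodic (v : 'rV[R]_d * R -> R) : Prop :=
  forall (z : 'rV[int]_d) (s : int) x t,
    v (x + map_mx intr z, t + s%:~R) = v (x, t).

(* Value at the point (x, t) of phi_t + H(x, t, c + phi_x). *)
Definition hj_operator L c (phi : 'rV[R]_d * R -> R) x t : R :=
  'D_1 (fun s => phi (x, s)) t
  + hamiltonian L x t (c + gradient (fun y => phi (y, t)) x).

Record viscosity_solution L c a (v : 'rV[R]_d * R -> R) : Prop :=
  ViscositySolution {
    viscosity_continuous : continuous v ;
    viscosity_periodic : periodic v ;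
    viscosity_sub : forall (phi : 'rV[R]_d * R -> R) x t, C1 phi ->
      (\forall z \near (x, t), v z - phi z <= v (x, t) - phi (x, t)) ->
      hj_operator L c phi x t <= a ;
    viscosity_super : forall (phi : 'rV[R]_d * R -> R) x t, C1 phi ->
      (\forall z \near (x, t), v (x, t) - phi (x, t) <= v z - phi z) ->
      a <= hj_operator L c phi x t }.

(* [a] is the unique number for which the equation is solvable. *)
Definition is_effective_hamiltonian L c a : Prop :=
  [set a' | exists v, viscosity_solution L c a' v] = [set a].

End Lagrangian.

(* The grid points x_m = h m and t_k = tau k are represented by the indices
   m : 'rV[int]_d and k.  A grid function is a total function of m (and k), of
   which only the values at indices of the relevant parity are meaningful: every
   condition below is restricted to that parity, and the scheme does not couple
   the two sublattices. *)
Section Scheme.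
Context {R : realType} {d : nat}.
Implicit Types (L : 'rV[R]_d * R * 'rV[R]_d -> R) (c : 'rV[R]_d).
Implicit Types (N K k l : nat) (m n : 'rV[int]_d) (w : 'rV[int]_d -> R).
Implicit Types (v : nat -> 'rV[int]_d -> R).

(* h = mesh N and tau = mesh K *)
Definition mesh N : R := (2 * N%:R)^-1.

Definition ratio N K : R := mesh K / mesh N.

Definition xpt N m : 'rV[R]_d := \row_j (mesh N * (m 0 j)%:~R).

Definition tpt K k : R := mesh K * k%:R.

Definition even_pt m : bool := (2 %| \sum_(j < d) m 0 j)%Z.

Definition odd_pt m : bool := ~~ even_pt m.

(* (x_m, t_k) belongs to G_delta, resp. to the dual grid *)
Definition in_grid k m : bool := even_pt m (+) odd k.

Definition in_dual_grid k m : bool := odd_pt m (+) odd k.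

(* The set B of unit steps is indexed by 'I_d * bool: (j, false) stands for
   e_j and (j, true) for - e_j. *)
Definition step (o : 'I_d * bool) : 'rV[int]_d := (-1) ^+ o.2 *: delta_mx 0 o.1.

Definition Dx N w m : 'rV[R]_d :=
  \row_j ((w (m + step (j, false)) - w (m + step (j, true))) / (2 * mesh N)).

Definition average w m : R :=
  (2 * d%:R)^-1 * \sum_(o : 'I_d * bool) w (m + step o).

(* (D_t v)^{k+1}_m *)
Definition Dt K v k m : R := (mesh K)^-1 * (v k.+1 m - average (v k) m).

(* [solmap L N K c w k] is phi^k_delta(w; c) *)
Fixpoint solmap L N K c w k : 'rV[int]_d -> R :=
  if k is k'.+1 then
    let v := solmap L N K c w k' in
    fun m => average v m
      - mesh K * hamiltonian L (xpt N m) (tpt K k') (c + Dx N v m)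
  else w.

Lemma solmap_scheme L N K c w k m : (0 < K)%N ->
  Dt K (solmap L N K c w) k m
  + hamiltonian L (xpt N m) (tpt K k) (c + Dx N (solmap L N K c w k) m) = 0.
Proof.
move=> K0; rewrite /Dt /= addrAC subrr sub0r mulrN mulKf ?addNr //.
by rewrite invr_eq0 mulf_neq0 ?pnatr_eq0 // -lt0n.
Qed.

Definition X (r : R) N w : Prop :=
  (forall m (j : 'I_d), odd_pt m -> w (m + delta_mx 0 j *+ (2 * N)%N) = w m) /\
  (forall m, even_pt m -> `|Dx N w m| <= r).

Definition is_discrete_effective_hamiltonian (r : R) L N K c (a : R) : Prop :=
  [set a' | exists2 w, X r N w &
     forall m, odd_pt m -> solmap L N K c w (2 * K)%N m + a' = w m] = [set a].

(* Backward random walk started from x_n at time t_{l+1}: the index o i is the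
   jump from t_{i+1} to t_i, and [walk n o k] is the position at time t_k. *)
Section Walk.
Variables (N K l : nat) (n : 'rV[int]_d) (xi : nat -> 'rV[int]_d -> 'rV[R]_d).
Implicit Types o : {ffun 'I_l.+1 -> 'I_d * bool}.

Definition walk o k : 'rV[int]_d := n + \sum_(i < l.+1 | (k <= i)%N) step (o i).

Definition jump_prob k m (s : 'I_d * bool) : R :=
  (2 * d%:R)^-1 - ratio N K / 2 * dot (map_mx intr (step s)) (xi k.+1 m).

Definition path_prob o : R :=
  \prod_(i < l.+1) jump_prob i (walk o i.+1) (o i).

Definition walk_expectation (F : (nat -> 'rV[int]_d) -> R) : R :=
  \sum_o path_prob o * F (walk o).

End Walk.

(* The control xi^k_m only matters at points of the dual grid with k > 0. *)
Definition control N K (xi : nat -> 'rV[int]_d -> 'rV[R]_d) : Prop :=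
  forall k m, in_dual_grid k.+1 m -> `|xi k.+1 m| <= (d%:R * ratio N K)^-1.

Definition cost L N K c w l n (xi : nat -> 'rV[int]_d -> 'rV[R]_d) : R :=
  walk_expectation N K l n xi (fun g =>
    \sum_(1 <= k < l.+2)
       tilted L c (xpt N (g k)) (tpt K k.-1) (xi k (g k)) * mesh K
    + w (g 0%N)).

Definition optimal_control L N K c w k m : 'rV[R]_d :=
  hamiltonian_p L (xpt N m) (tpt K k.-1)
    (c + Dx N (solmap L N K c w k.-1) m).

Record standing (P : set 'rV[R]_d) (r lambda1 : R) L N K : Prop := Standing {
  standing_stable : forall c w, P c -> X r N w ->
    X r N (solmap L N K c w (2 * K)%N) ;
  standing_speed : forall c w, P c -> X r N w ->
    forall k m, in_grid k m ->
      `|hamiltonian_p L (xpt N m) (tpt K k) (c + Dx N (solmap L N K c w k) m)|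
        <= (d%:R * lambda1)^-1 ;
  standing_value : forall c w, P c -> X r N w ->
    forall l n, in_dual_grid l.+1 n ->
      (solmap L N K c w l.+1 n)%:E
      = ereal_inf [set (cost L N K c w l n xi)%:E | xi in control N K] ;
  standing_minimizer : forall c w, P c -> X r N w ->
    control N K (optimal_control L N K c w) /\
    forall l n, in_dual_grid l.+1 n ->
      cost L N K c w l n (optimal_control L N K c w)
      = solmap L N K c w l.+1 n }.

Definition admissible (lambda0 lambda1 : R) N K : Prop :=
  [/\ (0 < N)%N, (0 < K)%N & lambda0 <= ratio N K < lambda1].

End Scheme.

(* Main.v *)
Require Import Defs.
From mathcomp Require Import all_boot all_order all_algebra.
From mathcomp Require Import perm.
From mathcomp Require Import all_classical all_reals all_analysis.
From mathcomp Require Import ring lra zify.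

Import Order.TTheory GRing.Theory Num.Theory.
Import numFieldNormedType.Exports.

Local Open Scope classical_set_scope.
Local Open Scope ring_scope.

(** Let g be a fixed point of the scheme, made periodic in time by adding a t_k,
    where a is the discrete effective Hamiltonian; it solves
    D_t g + H(x, t, c + D_x g) = a on the grid. Let v be a viscosity solution of the
    equation with right-hand side b, the exact one. Both inequalities between a and b
    follow from doubling of variables between v and a grid function with the penalty
    (|x - x_m|^2 + |t - t_k|^2) / s, where s is the square root of h. The viscosity
    inequalities are applied with this penalty as test function; all Lipschitz
    information comes from g and from H.

    Bounds. The speed bound confines H_p(x_m, t_k, c + D_x g) to a ball. Since H_p is
    the unique maximizer zeta of p.zeta - L (hamiltonian_p_maximizes) and p is the
    velocity gradient of L at zeta (maximizes_derive), the discrete gradients are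
    bounded at all times (maximizes_momentum_bounded). On bounded momenta H is
    bounded and Lipschitz. Differences between neighbours of a common point, which
    the discrete gradient does not control, are of order h because averaging over
    neighbours contracts them and g is periodic in time (cell_neighbours).

    a <= b + C s (discrete_le_viscosity). The test gradient p at the maximum need not
    satisfy the speed bound, so the scheme is not monotone there. By convexity
    H(c + p) lies above the tangent at c + D_x g, whose slope is an admissible
    velocity of the scheme, and monotonicity is needed for that velocity only
    (upwind_positivity).

    b <= a + C s (viscosity_le_discrete). This is the direction in which the scheme
    would have to be monotone at the test gradient. Instead g is replaced by its
    moving averages over about 1 / s steps along each of the 2d directions of the
    walk (smoothed_subsolution). By convexity of H these are still subsolutions, up
    to the oscillation of H over a length s, and their second differences are of
    order s h. At a maximum of a function with such second differences the discrete
    gradient is within O(s) of the test gradient, which gives the inequality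
    directly.

    In both cases the remaining errors are h / s from the curvature of the penalty
    and the Lipschitz constant of H times the distance O(s) between the two points. *)

Set Implicit Arguments.
Unset Strict Implicit.
Unset Printing Implicit Defensive.

(** * The maximum norm and the scalar product *)
Section Norms.
Context {R : realType} {d : nat}.
Implicit Types x p : 'rV[R]_d.

Lemma coord_le_norm x j : `|x 0 j| <= `|x|.
Proof.
rewrite [leRHS]mx_normrE.
exact: (le_bigmax _ (fun ij => `|x ij.1 ij.2|) (0, j)).
Qed.

Lemma norm_le_coord x B : 0 <= B -> (forall j, `|x 0 j| <= B) -> `|x| <= B.
Proof.
move=> B0 xB; rewrite [leLHS]mx_normrE; apply: bigmax_le => // -[i j] _ /=.
by rewrite ord1.
Qed.

Lemma dotC x p : dot x p = dot p x.
Proof. by apply: eq_bigr => j _; rewrite mulrC. Qed.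

Lemma dotDl x y p : dot (x + y) p = dot x p + dot y p.
Proof. by rewrite -big_split; apply: eq_bigr => j _; rewrite mxE mulrDl. Qed.

Lemma dotZl a x p : dot (a *: x) p = a * dot x p.
Proof. by rewrite mulr_sumr; apply: eq_bigr => j _; rewrite mxE mulrA. Qed.

Lemma dotBl x y p : dot (x - y) p = dot x p - dot y p.
Proof. by rewrite dotDl -scaleN1r dotZl mulN1r. Qed.

Lemma dotDr p x y : dot p (x + y) = dot p x + dot p y.
Proof. by rewrite dotC dotDl !(dotC _ p). Qed.

Lemma dotZr a p x : dot p (a *: x) = a * dot p x.
Proof. by rewrite dotC dotZl dotC. Qed.

Lemma dotBr p x y : dot p (x - y) = dot p x - dot p y.
Proof. by rewrite dotC dotBl !(dotC _ p). Qed.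

Lemma dot0r p : dot p 0 = 0.
Proof. by rewrite -(scale0r 0) dotZr mul0r. Qed.

Lemma dot_ebasis p j : dot p (ebasis j) = p 0 j.
Proof.
rewrite /dot (bigD1 j) //= /ebasis mxE !eqxx mulr1 big1 ?addr0 // => i ij.
by rewrite mxE (negbTE ij) andbF mulr0.
Qed.

Lemma norm_ebasis_le1 (j : 'I_d) : `|ebasis j : 'rV[R]_d| <= 1.
Proof.
apply: norm_le_coord => // i.
by rewrite mxE; case: (_ && _); rewrite ?normr1 ?normr0.
Qed.

Lemma norm_dot_le x p : `|dot x p| <= d%:R * (`|x| * `|p|).
Proof.
apply: (le_trans (ler_norm_sum _ _ _)).
apply: (@le_trans _ _ (\sum_(j < d) `|x| * `|p|)).
  by apply: ler_sum => j _; rewrite normrM ler_pM // coord_le_norm.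
by rewrite sumr_const card_ord mulr_natl.
Qed.

Lemma norm_le_enorm x : `|x| <= enorm x.
Proof.
apply: norm_le_coord => [|j]; first exact: sqrtr_ge0.
rewrite -sqrtr_sqr; apply: ler_wsqrtr; rewrite /dot (bigD1 j) //= -expr2.
by rewrite lerDl; apply: sumr_ge0 => i _; rewrite -expr2 sqr_ge0.
Qed.

End Norms.

(** * Directional derivatives of continuously differentiable functions *)
Lemma near_dist_lt {R : realType} {V : normedModType R} (z : V) (a : R) :
  0 < a -> \forall y \near z, `|z - y| < a.
Proof. by move=> a0; apply/nbhs_ballP; exists a => // y; rewrite -ball_normE. Qed.

Section DirectionalDerivative.
Context {R : realType} {V : normedModType R}.
Implicit Types (f : V -> R) (x v : V) (s : R).

Lemma is_derive_line f x v s : derivable f (x + s *: v) v ->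
  is_derive s 1 (fun s => f (x + s *: v)) ('D_v f (x + s *: v)).
Proof.
move=> fd; have E : (fun h : R => h^-1 *: (((fun s => f (x + s *: v)) \o shift s) (h *: 1)
    - f (x + s *: v))) = (fun h => h^-1 *: ((f \o shift (x + s *: v)) (h *: v) - f (x + s *: v))).
  apply/funext => h /=; congr (_ *: (f _ - _)).
  by rewrite [h *: 1]mulr1 scalerDl addrCA.
by constructor; rewrite /derivable /derive E.
Qed.

(** The mean value theorem, with the intermediate point located only up to sign so
    that s may be negative. *)
Lemma mvt_line f x v s : C1 f ->
  exists2 r, `|r| <= `|s| & f (x + s *: v) - f x = s * 'D_v f (x + r *: v).
Proof.
move=> fC1; have D r := @is_derive_line f x v r ((fC1 v).1 _).
have C A : {within A, continuous (fun s : R => f (x + s *: v))}.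
  apply: continuous_subspaceT => r; apply/differentiable_continuous.
  by rewrite -derivable1_diffP; case: (D r).
have [s0|/ltW s0] := leP 0 s.
  have [r] := @MVT_segment _ _ _ 0 s s0 (fun r _ => D r) (C _).
  rewrite in_itv /= => /andP[r0 rs]; rewrite scale0r addr0 subr0 mulrC => ->.
  by exists r => //; rewrite !ger0_norm.
have [r] := @MVT_segment _ _ _ s 0 s0 (fun r _ => D r) (C _).
rewrite in_itv /= => /andP[sr r0]; rewrite scale0r addr0 sub0r => E.
by exists r; [rewrite !ler0_norm ?lerN2|rewrite -opprB E mulrN opprK mulrC].
Qed.


Lemma cvg_derive_line f x u v w : C1 f ->
  forall e, 0 < e -> \forall s \near (0 : R), forall a b, `|a| <= `|s| -> `|b| <= `|s| ->
    `|'D_w f x - 'D_w f (x + a *: u + b *: v)| <= e.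
Proof.
move=> fC1 e e0; have /cvgrPdist_le/(_ e e0)/nbhs_ballP[r /= r0 br] := (fC1 w).2 x.
have M0 : 0 < `|u| + `|v| + 1 by rewrite ltr_wpDl // addr_ge0.
near=> s => a b als bls; apply: br; rewrite -ball_normE /ball_ /= -addrA opprD addNKr.
rewrite normrN; apply: (le_lt_trans (ler_normD _ _)); rewrite !normrZ.
have sr : `|s| * (`|u| + `|v| + 1) < r.
  rewrite -ltr_pdivlMr //; by near: s; apply: (@nbhs0_lt R R^o); rewrite divr_gt0.
apply: le_lt_trans sr; rewrite !mulrDr mulr1.
have := ler_wpM2r (normr_ge0 u) als; have := ler_wpM2r (normr_ge0 v) bls.
have := normr_ge0 s; lra.
Unshelve. all: by end_near. Qed.

(** The increment along u + v is the sum of an increment along u and one along v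
    from a nearby base point; the mean value theorem and continuity of the two
    directional derivatives give the limit. *)
Lemma derive_add f x u v : C1 f -> 'D_(u + v) f x = 'D_u f x + 'D_v f x.
Proof.
move=> fC1; apply: (@cvg_lim _ _ _ 0^'); first exact: norm_hausdorff.
apply/cvgrPdist_le => e e0; have e20 : 0 < e / 2 by rewrite divr_gt0.
have /nbhs_dnbhs Nu := cvg_derive_line x u v u fC1 e20.
have /nbhs_dnbhs Nv := cvg_derive_line x u v v fC1 e20.
near=> s.
have s0 : s != 0 by near: s; exact: nbhs_dnbhs_neq.
rewrite /= (_ : s *: (u + v) + x = x + s *: u + s *: v); last by rewrite scalerDr addrC addrA.
have [r rs E1] := mvt_line x u s fC1.
have [q qs E2] := mvt_line (x + s *: u) v s fC1.
have -> : f (x + s *: u + s *: v) - f x =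
   s * 'D_v f (x + s *: u + q *: v) + s * 'D_u f (x + r *: u).
  by rewrite -E1 -E2 addrA subrK.
rewrite -mulrDr; rewrite [_ *: _]mulKf //.
have D1 : `|'D_u f x - 'D_u f (x + r *: u + 0 *: v)| <= e / 2.
  have C : forall a b, `|a| <= `|s| -> `|b| <= `|s| ->
    `|'D_u f x - 'D_u f (x + a *: u + b *: v)| <= e / 2 by near: s; exact: Nu.
  by apply: C; rewrite ?normr0.
have D2 : `|'D_v f x - 'D_v f (x + s *: u + q *: v)| <= e / 2.
  have C : forall a b, `|a| <= `|s| -> `|b| <= `|s| ->
    `|'D_v f x - 'D_v f (x + a *: u + b *: v)| <= e / 2 by near: s; exact: Nv.
  exact: C.
rewrite scale0r addr0 in D1.
rewrite [X in _ - X]addrC opprD addrACA [e]splitr.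
exact: le_trans (ler_normD _ _) (lerD D1 D2).
Unshelve. all: by end_near. Qed.

Lemma derive_scale f x a v : C1 f -> 'D_(a *: v) f x = a * 'D_v f x.
Proof.
move=> fC1; have [->|a0] := eqVneq a 0; first by rewrite scale0r derive0 mul0r.
have := @is_derive_line f x v 0 ((fC1 v).1 _); rewrite scale0r addr0 => D.
have D' : is_derive (a * 0) 1 (fun s : R => f (x + s *: v)) ('D_v f x) by rewrite mulr0.
have Da : is_derive (0 : R) (1 : R) (fun s : R => a * s) a.
  have : is_derive (0 : R) (1 : R) (a *: @id R) (a *: (1 : R)) by exact: is_deriveZ.
  by rewrite [a *: 1]mulr1.
have := is_derive1_comp D' Da; rewrite /comp => -[_ E].
have := @is_derive_line f x (a *: v) 0 ((fC1 _).1 _); rewrite scale0r addr0 => -[_ <-].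
rewrite mulrC -E (_ : (fun s : R => f (x + s *: (a *: v))) = fun s => f (x + (a * s) *: v)) //.
by apply/funext => s; rewrite scalerA mulrC.
Qed.

Lemma derive_sum_dir f x (I : Type) (r : seq I) (v : I -> V) : C1 f ->
  'D_(\sum_(i <- r) v i) f x = \sum_(i <- r) 'D_(v i) f x.
Proof.
move=> fC1; elim/big_rec2: _ => [|i y z _ E]; first exact: derive0.
by rewrite derive_add // E.
Qed.

End DirectionalDerivative.

(** * Periodic functions of (x, t) over bounded velocities *)
Section CompactPeriodic.
Context {R : realType} {d : nat}.
Implicit Types (x : 'rV[R]_d) (t Z : R).

Lemma rV_ball_compact Z : compact [set x : 'rV[R]_d | `|x| <= Z].
Proof.
apply: bounded_closed_compact.
  exists Z; split; first exact: num_real.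
  by move=> M /ltW ZM x /= xZ; exact: le_trans ZM.
rewrite (_ : mkset _ = (fun x : 'rV[R]_d => `|x|) @^-1` [set r : R | r <= Z]) //.
by apply: closed_comp => [x _|]; [exact: norm_continuous|exact: closed_le].
Qed.

Lemma interval_ball_compact Z : compact [set t : R | `|t| <= Z].
Proof.
rewrite (_ : mkset _ = [set` `[-Z, Z]]); first exact: segment_compact.
by apply/funext => t; rewrite /= in_itv /= ler_norml.
Qed.

Lemma translate_to_cube x t : exists (z : 'rV[int]_d) (s : int),
  `|x + map_mx intr z| <= 1 /\ `|t + s%:~R| <= 1.
Proof.
have frac (r : R) : `|r + (- Num.floor r)%:~R| <= 1.
  have := real_floor_itv (num_real r); rewrite intrD mulrNz => /andP[? ?].
  by rewrite ler_norml; apply/andP; split; lra.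
exists (\row_j - Num.floor (x 0 j)), (- Num.floor t); split => //.
by apply: norm_le_coord => // j; rewrite !mxE.
Qed.

Lemma periodic_bounded (G : 'rV[R]_d * R * 'rV[R]_d -> R) Z :
  continuous G ->
  (forall (z : 'rV[int]_d) (s : int) x t y,
    G (x + map_mx intr z, t + s%:~R, y) = G (x, t, y)) ->
  exists B, forall x t y, `|y| <= Z -> `|G (x, t, y)| <= B.
Proof.
move=> Gc Gper; have [Z0|Z0] := ltP Z 0.
  by exists 0 => x t y yZ; have := le_lt_trans yZ Z0; rewrite normr_lt0.
pose K := [set x : 'rV[R]_d | `|x| <= 1] `*` [set t : R | `|t| <= 1]
  `*` [set y : 'rV[R]_d | `|y| <= Z].
have Kc : compact K.
  apply: compact_setX; last exact: rV_ball_compact.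
  by apply: compact_setX; [exact: rV_ball_compact|exact: interval_ball_compact].
have K0 : K !=set0 by exists (0, 0, 0); rewrite /K /=; rewrite !normr0 ler01.
have [|c _ cmax] := @compact_EVT_max _ R (fun z => `|G z|) K K0 Kc.
  apply: continuous_subspaceT => z; apply: continuous_comp; first exact: Gc.
  exact: norm_continuous.
exists `|G c| => x t y yZ; have [z [s [xz ts]]] := translate_to_cube x t.
by rewrite -(Gper z s); apply: cmax; rewrite inE.
Qed.

End CompactPeriodic.

(** * Functions of position, time and velocity *)
Section Slice.
Context {R : realType} {d : nat}.
Implicit Types (f : 'rV[R]_d * R * 'rV[R]_d -> R) (x y : 'rV[R]_d) (t : R).

Lemma tripleD x t y x' t' y' :
  (x, t, y) + (x', t', y') = (x + x', t + t', y + y') :> 'rV[R]_d * R * 'rV[R]_d.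
Proof. by []. Qed.

Lemma tripleZ (a : R) x t y :
  a *: (x, t, y) = (a *: x, a * t, a *: y) :> 'rV[R]_d * R * 'rV[R]_d.
Proof. by []. Qed.

Lemma triple_norm x t y :
  `|(x, t, y) : 'rV[R]_d * R * 'rV[R]_d| = Num.max (Num.max `|x| `|t|) `|y|.
Proof. by []. Qed.

Lemma slice_quotient f x t eta y (h : R) :
  h^-1 *: (((fun eta => f (x, t, eta)) \o shift eta) (h *: y) - f (x, t, eta))
  = h^-1 *: ((f \o shift (x, t, eta)) (h *: (0, 0, y)) - f (x, t, eta)).
Proof.
by rewrite /= tripleZ tripleD scaler0 add0r mulr0 add0r.
Qed.

Lemma derive_slice f x t eta y :
  'D_y (fun eta => f (x, t, eta)) eta = 'D_(0, 0, y) f (x, t, eta).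
Proof. by rewrite /derive (funext (slice_quotient f x t eta y)). Qed.

Lemma C1_slice f x t : C1 f -> C1 (fun eta => f (x, t, eta)).
Proof.
move=> fC1 y; split => [eta|].
  have := (fC1 (0, 0, y)).1 (x, t, eta).
  by rewrite /derivable (funext (slice_quotient f x t eta y)).
rewrite (_ : (fun eta => _) = 'D_(0, 0, y) f \o (fun eta => (x, t, eta))); last first.
  by apply/funext => eta; exact: derive_slice.
move=> eta; have C : (fun eta => (x, t, eta)) @ eta --> (x, t, eta).
  have C1' : (fun _ : 'rV[R]_d => (x, t)) @ eta --> (x, t) :=
    @cvg_cst _ (x, t) _ (nbhs eta) (nbhs_filter eta).
  exact: (cvg_pair C1' (@cvg_id _ (nbhs eta))).
exact: (cvg_comp _ _ C ((fC1 (0, 0, y)).2 (x, t, eta))).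
Qed.

Lemma derive_coords (f : 'rV[R]_d -> R) x y : C1 f ->
  'D_y f x = \sum_j y 0 j * 'D_(ebasis j) f x.
Proof.
move=> fC1; rewrite {1}[y]row_sum_delta derive_sum_dir //.
by apply: eq_bigr => j _; rewrite derive_scale.
Qed.


(** The dual norm of the differential for the maximum norm, so that it bounds every
    directional derivative; unlike the differential itself it is a continuous
    scalar, hence bounded over a compact set. *)
Definition grad_norm1 f z : R :=
  \sum_j `|'D_(ebasis j, 0, 0) f z| + `|'D_(0, 1, 0) f z|
  + \sum_j `|'D_(0, 0, ebasis j) f z|.

Lemma grad_norm1_continuous f : C1 f -> continuous (grad_norm1 f).
Proof.
move=> fC1 z; have C v : (fun z => `|'D_v f z|) @ z --> `|'D_v f z|.
  by apply: cvg_norm; exact: (fC1 v).2.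
have S (v : 'I_d -> 'rV[R]_d * R * 'rV[R]_d) :
    (fun z => \sum_j `|'D_(v j) f z|) @ z --> \sum_j `|'D_(v j) f z|.
  by apply: cvg_big => [|j _]; [exact: add_continuous|exact: C].
exact: (cvgD (cvgD (S _) (C _)) (S _)).
Qed.

Lemma derive_le_grad_norm1 f z v : C1 f -> `|'D_v f z| <= `|v| * grad_norm1 f z.
Proof.
move=> fC1; case: v => [[u s] w].
have E1 (I : Type) (r : seq I) F :
    ((\sum_(j <- r) F j, 0, 0) : 'rV[R]_d * R * 'rV[R]_d) = \sum_(j <- r) (F j, 0, 0).
  elim/big_rec2: _ => // j _ y _ <-.
  by rewrite tripleD !add0r.
have E2 (I : Type) (r : seq I) F :
    ((0, 0, \sum_(j <- r) F j) : 'rV[R]_d * R * 'rV[R]_d) = \sum_(j <- r) (0, 0, F j).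
  elim/big_rec2: _ => // j _ y _ <-.
  by rewrite tripleD !add0r.
have B v a : `|a| <= `|(u, s, w)| -> `|'D_(a *: v) f z| <= `|(u, s, w)| * `|'D_v f z|.
  by move=> ?; rewrite derive_scale // normrM ler_wpM2r.
have nu : `|u| <= `|(u, s, w)| by rewrite triple_norm !le_max lexx.
have ns : `|s| <= `|(u, s, w)| by rewrite triple_norm !le_max lexx orbT.
have nw : `|w| <= `|(u, s, w)| by rewrite triple_norm !le_max lexx orbT.
move: B nu ns nw; set M := `|(u, s, w)| => B nu ns nw.
have -> : (u, s, w) = (u, 0, 0) + s *: (0, 1, 0) + (0, 0, w).
  by rewrite tripleZ !tripleD !(addr0, add0r, scaler0, mulr1).
have -> : (u, 0, 0) = \sum_j u 0 j *: (ebasis j, 0, 0) :> 'rV[R]_d * R * 'rV[R]_d.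
  rewrite {1}[u]row_sum_delta E1; apply: eq_bigr => j _.
  by rewrite tripleZ scaler0 mulr0.
have -> : (0, 0, w) = \sum_j w 0 j *: (0, 0, ebasis j) :> 'rV[R]_d * R * 'rV[R]_d.
  rewrite {1}[w]row_sum_delta E2; apply: eq_bigr => j _.
  by rewrite tripleZ scaler0 mulr0.
rewrite !derive_add // !derive_sum_dir // /grad_norm1 !mulrDr.
apply: (le_trans (ler_normD _ _)); apply: lerD.
  apply: (le_trans (ler_normD _ _)); apply: lerD; last exact: B.
  rewrite mulr_sumr; apply: (le_trans (ler_norm_sum _ _ _)); apply: ler_sum => j _.
  by apply: B; exact: le_trans (coord_le_norm _ _) nu.
rewrite mulr_sumr; apply: (le_trans (ler_norm_sum _ _ _)); apply: ler_sum => j _.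
by apply: B; exact: le_trans (coord_le_norm _ _) nw.
Qed.

Lemma C1_lipschitz f z v B : C1 f ->
  (forall s, `|s| <= 1 -> grad_norm1 f (z + s *: v) <= B) ->
  `|f (z + v) - f z| <= B * `|v|.
Proof.
move=> fC1 fB; have [s] := mvt_line z v 1 fC1; rewrite normr1 scale1r mul1r => s1 ->.
apply: (le_trans (derive_le_grad_norm1 _ _ fC1)); rewrite mulrC.
by apply: ler_wpM2r => //; exact: fB.
Qed.

Lemma C1_continuous f : C1 f -> continuous f.
Proof.
move=> fC1 z; apply/cvgrPdist_le => e e0.
have /cvgrPdist_le/(_ 1 ltr01)/nbhs_ballP[r /= r0 br] := grad_norm1_continuous fC1 (x := z).
pose B := grad_norm1 f z + 1.
have B0 : 0 < B by rewrite ltr_wpDl // !addr_ge0 // sumr_ge0.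
have N1 := near_dist_lt z r0; have N2 := near_dist_lt z (divr_gt0 e0 B0).
near=> y.
have yr : `|z - y| < r by near: y.
have -> : f z - f y = - (f (z + (y - z)) - f z) by rewrite addrCA subrr addr0 opprB.
rewrite normrN.
apply: (@le_trans _ _ (B * `|y - z|)).
  apply: C1_lipschitz => // s s1.
  have := br (z + s *: (y - z)); rewrite /= -ball_normE /= opprD addNKr normrN normrZ.
  rewrite distrC in yr; rewrite (le_lt_trans _ yr) ?ler_piMl // => /(_ isT).
  by rewrite ler_norml /B => /andP[]; lra.
rewrite mulrC -ler_pdivlMr // distrC; apply: ltW; by near: y.
Unshelve. all: by end_near. Qed.

End Slice.

(** * The Legendre transform *)
Lemma dot_continuous {R : realType} {d : nat} (p : 'rV[R]_d) :
  continuous (dot p).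
Proof.
move=> eta; rewrite /dot /continuous_at.
have C (j : 'I_d) : (fun eta : 'rV[R]_d => p 0 j * eta 0 j) @ eta --> p 0 j * eta 0 j.
  exact: (@cvgMl_tmp R _ (nbhs eta) (nbhs_filter eta) _ (p 0 j) _ (@coord_continuous R 1 d 0 j eta)).
by apply: (@cvg_big _ _ _ _ _ (@add_continuous _) _ (nbhs eta)) => j _; exact: C.
Qed.

Section Legendre.
Context {R : realType} {d : nat}.
Variables (L : 'rV[R]_d * R * 'rV[R]_d -> R) (hL : lagrangian L).
Implicit Types (x p zeta eta y : 'rV[R]_d) (t : R).

Lemma lagrangian_bounded Z : exists B, forall x t zeta,
  `|zeta| <= Z -> `|L (x, t, zeta)| <= B.
Proof.
apply: periodic_bounded; last exact: (lagrangian_periodic hL).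
exact: C1_continuous (lagrangian_C2 hL).1.
Qed.

Lemma lagrangian_derive_periodic v (z : 'rV[int]_d) (s : int) x t zeta :
  'D_v L (x + map_mx intr z, t + s%:~R, zeta) = 'D_v L (x, t, zeta).
Proof.
pose Q A (h : R) := h^-1 *: ((L \o shift A) (h *: v) - L A).
suff E : Q (x + map_mx intr z, t + s%:~R, zeta) = Q (x, t, zeta).
  by move: E; rewrite /Q /derive => ->.
apply/funext => h; rewrite /Q /= (lagrangian_periodic hL); congr (_ *: (_ - _)).
case: v @Q => [[u r] w] _; rewrite !tripleZ !tripleD !addrA.
exact: lagrangian_periodic.
Qed.

Lemma grad_norm1_bounded Z : exists B, forall x t zeta,
  `|zeta| <= Z -> `|grad_norm1 L (x, t, zeta)| <= B.
Proof.
apply: periodic_bounded => [|z s x t y]; first exact: grad_norm1_continuous (lagrangian_C2 hL).1.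
rewrite /grad_norm1 lagrangian_derive_periodic.
by congr (_ + _ + _); apply: eq_bigr => j _; rewrite lagrangian_derive_periodic.
Qed.

Lemma lagrangian_lipschitz Z : exists2 C, 0 <= C & forall x t x' t' zeta,
  `|zeta| <= Z -> `|L (x', t', zeta) - L (x, t, zeta)| <= C * (`|x' - x| + `|t' - t|).
Proof.
have LC1 := (lagrangian_C2 hL).1.
have [B LB] := grad_norm1_bounded Z.
exists `|B| => // x t x' t' zeta zZ.
have -> : (x', t', zeta) = (x, t, zeta) + (x' - x, t' - t, 0).
  by rewrite tripleD addr0 !(addrC _ (_ - _)) !subrK.
apply: (@le_trans _ _ (`|B| * `|(x' - x, t' - t, 0 : 'rV[R]_d)|)).
  apply: C1_lipschitz => // s _; rewrite tripleZ tripleD scaler0 addr0.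
  exact: (le_trans (ler_norm _) (le_trans (LB _ _ _ zZ) (ler_norm _))).
apply: ler_wpM2l => //; rewrite triple_norm normr0 !ge_max lerDl lerDr !normr_ge0 /=.
by rewrite addr_ge0.
Qed.

Definition maximizes x t p zeta : Prop :=
  forall eta, dot p eta - L (x, t, eta) <= dot p zeta - L (x, t, zeta).

Lemma gain_continuous x t p : continuous (fun eta => dot p eta - L (x, t, eta)).
Proof.
move=> eta.
have C1' : (fun _ : 'rV[R]_d => (x, t)) @ eta --> (x, t) :=
  @cvg_cst _ (x, t) _ (nbhs eta) (nbhs_filter eta).
have C : (fun eta => (x, t, eta)) @ eta --> (x, t, eta).
  exact: (cvg_pair C1' (@cvg_id _ (nbhs eta))).
have D := cvg_comp _ _ C (C1_continuous (lagrangian_C2 hL).1 (x := (x, t, eta))).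
exact: (cvgB (@dot_continuous R d p eta) D).
Qed.

(** Superlinearity with slope larger than the momentum makes velocities outside a
    ball worse than rest; the ball depends only on the bound on the momentum. *)
Lemma maximizer_exists rho : exists2 Z, 0 <= Z & forall x t p, `|p| <= rho ->
  exists2 zeta, `|zeta| <= Z & maximizes x t p zeta.
Proof.
have [B LB] := lagrangian_bounded 0.
have a0 : 0 <= d%:R * `|rho| + 1 by rewrite addr_ge0 // mulr_ge0.
have [b Lb] := lagrangian_superlinear hL a0.
exists (Num.max 0 (B - b)) => [|x t p prho]; first by rewrite le_max lexx.
set Z := Num.max 0 (B - b).
have Z0 : 0 <= Z by rewrite le_max lexx.
have [||zeta zZ zmax] := @compact_EVT_max _ R (fun eta => dot p eta - L (x, t, eta))
    _ _ (@rV_ball_compact R d Z).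
- by exists 0; rewrite /= normr0.
- apply: continuous_subspaceT.
  exact: gain_continuous.
exists zeta; first by move: zZ; rewrite inE.
move=> eta; have [etaZ|etaZ] := leP `|eta| Z; first by apply: zmax; rewrite inE.
have := zmax 0; rewrite inE /= normr0 => /(_ Z0); apply: le_trans.
rewrite dot0r sub0r; have := LB x t 0; rewrite normr0 => /(_ (lexx _)).
rewrite ler_norml => /andP[_ LB0].
have H1 := Lb x t eta; have H2 := ler_wpM2l a0 (norm_le_enorm eta).
have H3 : dot p eta <= d%:R * `|rho| * `|eta|.
  apply: (le_trans (ler_norm _)); apply: (le_trans (norm_dot_le _ _)).
  rewrite -mulrA ler_wpM2l // ler_wpM2r //; exact: le_trans prho (ler_norm _).
have H4 : B - b <= Z by rewrite le_max lexx orbT.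
lra.
Qed.

Lemma hamiltonian_maximizes x t p zeta : maximizes x t p zeta ->
  hamiltonian L x t p = dot p zeta - L (x, t, zeta).
Proof.
move=> zmax; apply/eqP; rewrite eq_le; apply/andP; split.
  by apply: ge_sup => [|_ [eta _ <-]]; [exists (dot p 0 - L (x, t, 0)), 0|exact: zmax].
apply: ub_le_sup; last by exists zeta.
by exists (dot p zeta - L (x, t, zeta)) => _ [eta _ <-]; exact: zmax.
Qed.

Lemma maximizer x t p : exists zeta, maximizes x t p zeta.
Proof. by have [Z _ /(_ x t p (lexx _)) [zeta]] := maximizer_exists `|p|; exists zeta. Qed.

Lemma hamiltonian_ge x t p eta : dot p eta - L (x, t, eta) <= hamiltonian L x t p.
Proof. by have [zeta zmax] := maximizer x t p; rewrite (hamiltonian_maximizes zmax). Qed.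

Lemma hamiltonian_periodic (z : 'rV[int]_d) (s : int) x t p :
  hamiltonian L (x + map_mx intr z) (t + s%:~R) p = hamiltonian L x t p.
Proof.
rewrite /hamiltonian; congr sup; congr image; apply/funext => eta.
by rewrite (lagrangian_periodic hL).
Qed.

(** H is a supremum of functions of (x, t, p); a maximizer at one point is a
    competitor at the other, and it is bounded in terms of rho. *)
Lemma hamiltonian_lipschitz rho : exists2 C, 0 <= C & forall x t p x' t' p',
  `|p| <= rho -> `|p'| <= rho ->
  hamiltonian L x t p - hamiltonian L x' t' p' <= C * (`|x - x'| + `|t - t'| + `|p - p'|).
Proof.
have [Z Z0 hZ] := maximizer_exists rho; have [C C0 hC] := lagrangian_lipschitz Z.
exists (C + d%:R * Z) => [|x t p x' t' p' prho p'rho]; first by rewrite addr_ge0 // mulr_ge0.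
have [zeta zZ zmax] := hZ x t p prho; rewrite (hamiltonian_maximizes zmax).
have H1 := hamiltonian_ge x' t' p' zeta.
have := hC x t x' t' zeta zZ; rewrite ler_norml !(distrC x') !(distrC t') => /andP[_ H2].
have : dot (p - p') zeta <= d%:R * Z * `|p - p'|.
  apply: (le_trans (ler_norm _)); apply: (le_trans (norm_dot_le _ _)).
  by rewrite -mulrA ler_wpM2l // mulrC ler_wpM2r.
rewrite dotBl => H3.
have H4 : 0 <= C * `|p - p'| by rewrite mulr_ge0.
have H5 : 0 <= d%:R * Z * (`|x - x'| + `|t - t'|) by rewrite !mulr_ge0 // addr_ge0.
lra.
Qed.

Lemma hamiltonian_bounded rho : exists2 C, 0 <= C & forall x t p,
  `|p| <= rho -> `|hamiltonian L x t p| <= C.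
Proof.
have [Z Z0 hZ] := maximizer_exists rho; have [B hB] := lagrangian_bounded Z.
exists (`|B| + d%:R * `|rho| * Z) => [|x t p prho]; first by rewrite addr_ge0 // !mulr_ge0.
have [zeta zZ zmax] := hZ x t p prho; rewrite (hamiltonian_maximizes zmax).
apply: (le_trans (ler_normB _ _)); rewrite addrC; apply: lerD.
  exact: (le_trans (hB _ _ _ zZ) (ler_norm _)).
apply: (le_trans (norm_dot_le _ _)); rewrite -mulrA ler_wpM2l // ler_pM //.
exact: le_trans (ler_norm _).
Qed.

(** Jensen's inequality: a maximizer at the mean momentum competes at each of the
    momenta. *)
Lemma hamiltonian_average x t n (p : 'I_n.+1 -> 'rV[R]_d) :
  hamiltonian L x t (n.+1%:R^-1 *: \sum_i p i)
  <= n.+1%:R^-1 * \sum_i hamiltonian L x t (p i).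
Proof.
have [zeta zmax] := maximizer x t (n.+1%:R^-1 *: \sum_i p i).
rewrite (hamiltonian_maximizes zmax) dotZl.
have -> : dot (\sum_i p i) zeta = \sum_i dot (p i) zeta.
  by apply: (big_morph (fun v => dot v zeta)) => [v w|]; rewrite ?dotDl // dotC dot0r.
rewrite -(@ler_pM2l _ n.+1%:R) // mulrBr !mulVKf //.
rewrite mulr_natl -[X in _ - _ *+ X]card_ord -sumr_const -sumrB.
by apply: ler_sum => i _; exact: hamiltonian_ge.
Qed.

(** A maximizer is a critical point of eta |-> p.eta - L(x, t, eta) along every
    line through it. *)
Lemma maximizes_derive x t p zeta y : maximizes x t p zeta ->
  'D_y (fun eta => L (x, t, eta)) zeta = dot p y.
Proof.
move=> zmax; set g := fun eta => L (x, t, eta).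
have gC1 : C1 g by exact: C1_slice (lagrangian_C2 hL).1.
pose F (s : R) := dot p zeta + s * dot p y - g (zeta + s *: y).
have dF (s : R) : is_derive s (1 : R) F (dot p y - 'D_y g (zeta + s *: y)).
  have Da : is_derive s (1 : R) (fun s : R => dot p zeta + s * dot p y) (dot p y).
    have : is_derive s (1 : R) (cst (dot p zeta) + (dot p y *: @id R)) (0 + (dot p y *: (1 : R))).
      exact: is_deriveD.
    rewrite add0r [_ *: 1]mulr1; congr is_derive; apply/funext => r.
    by rewrite mulrC.
  have Db := @is_derive_line _ _ g zeta y s ((gC1 y).1 _).
  exact: is_deriveB.
have F0 : is_derive (0 : R) (1 : R) F 0.
  apply: (@derive1_at_max _ F (-1) 1) => //.
  - by rewrite in_itv /= ltrN10 ltr01.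
  - move=> s _; rewrite /F /g scale0r addr0 mul0r addr0 -dotZr -dotDr; exact: zmax.
have [_ E0] := F0; have [_] := dF 0; rewrite E0 scale0r addr0.
by move/eqP; rewrite eq_sym subr_eq0 => /eqP ->.
Qed.

(** The momentum at a maximizer is a partial gradient of L there, and L has
    bounded partial gradients over bounded velocities: a bound on the velocity
    is a bound on the momentum. *)
Lemma maximizes_momentum_bounded Z : exists2 rho, 0 <= rho & forall x t p zeta,
  maximizes x t p zeta -> `|zeta| <= Z -> `|p| <= rho.
Proof.
have LC1 := (lagrangian_C2 hL).1.
have [B LB] := grad_norm1_bounded Z.
exists `|B| => // x t p zeta zmax zZ; apply: norm_le_coord => // j.
rewrite -(dot_ebasis p j) -(maximizes_derive (ebasis j) zmax) derive_slice.
apply: (le_trans (derive_le_grad_norm1 _ _ LC1)).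
have e1 : `|(0, 0, ebasis j) : 'rV[R]_d * R * 'rV[R]_d| <= 1.
  rewrite triple_norm !normr0 !ge_max ler01 /=; exact: norm_ebasis_le1.
have G0 : 0 <= grad_norm1 L (x, t, zeta) by rewrite !addr_ge0 // sumr_ge0.
apply: (le_trans (ler_wpM2r G0 e1)); rewrite mul1r.
exact: (le_trans (ler_norm _) (le_trans (LB _ _ _ zZ) (ler_norm _))).
Qed.

(** Rolle's theorem applied to the derivative of L along the segment between two
    maximizers would give a zero of a positive second derivative. *)
Lemma maximizer_unique x t p zeta zeta' :
  maximizes x t p zeta -> maximizes x t p zeta' -> zeta = zeta'.
Proof.
move=> zmax z'max; apply/eqP; rewrite eq_sym -subr_eq0; apply/negP => /negP y0.
set y := zeta' - zeta in y0; set g := fun eta => L (x, t, eta).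
have gC1 : C1 g by exact: C1_slice (lagrangian_C2 hL).1.
have gjC1 v : C1 (fun eta => 'D_v g eta).
  rewrite (_ : (fun eta => _) = fun eta => 'D_(0, 0, v) L (x, t, eta)).
    exact: C1_slice ((lagrangian_C2 hL).2 _).
  by apply/funext => eta; exact: derive_slice.
have D (s : R) := @is_derive_line _ _ (fun eta => 'D_y g eta) zeta y s ((gjC1 y y).1 _).
have [||||c _ [_ Ec]] := @Rolle _ (fun s : R => 'D_y g (zeta + s *: y)) 0 1.
- exact: ltr01.
- by move=> s _; case: (D s).
- apply: continuous_subspaceT => s; apply/differentiable_continuous.
  by rewrite -derivable1_diffP; case: (D s).
- rewrite scale0r addr0 scale1r addrC subrK.
  by rewrite (maximizes_derive _ zmax) (maximizes_derive _ z'max).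
have [_] := D c; rewrite Ec => E0.
have := lagrangian_convex hL x t (zeta + c *: y) y0; rewrite -/g.
suff -> : (y *m hessian g (zeta + c *: y) *m y^T) 0 0 = 'D_y (fun eta => 'D_y g eta) (zeta + c *: y).
  by rewrite -E0 ltxx.
rewrite -mulmxA mxE derive_coords //; apply: eq_bigr => i _; congr (_ * _).
rewrite mxE (_ : (fun eta => 'D_y g eta)
    = \sum_(j < d) (y 0 j \*: (fun eta => 'D_(ebasis j) g eta))); last first.
  apply/funext => eta; rewrite derive_coords // fct_sumE; apply: eq_bigr => j _ //.
rewrite derive_sum => [|j]; last by apply: derivableZ; exact: (gjC1 _ _).1.
apply: eq_bigr => j _; rewrite deriveZ; last exact: (gjC1 _ _).1.
by rewrite !mxE mulrC.
Qed.

(** The difference quotient of H in the direction e_j at p lies between the j-th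
    coordinates of the maximizers at p and at the shifted momentum; by uniqueness
    and compactness the latter maximizers converge to the former. *)
Lemma hamiltonian_p_maximizes x t p zeta : maximizes x t p zeta ->
  hamiltonian_p L x t p = zeta.
Proof.
move=> zmax; apply/rowP => j; rewrite mxE.
apply: (@cvg_lim _ _ _ 0^'); first exact: norm_hausdorff.
apply/cvgrPdist_le => e e0.
have [Z Z0 hZ] := maximizer_exists (`|p| + 1).
have zZ : `|zeta| <= Z.
  have [|zeta' z'Z z'max] := hZ x t p; first by rewrite lerDl.
  by rewrite (maximizer_unique zmax z'max).
pose F eta := dot p eta - L (x, t, eta).
(* By uniqueness the maximum over velocities at distance at least e is strictly
   smaller. *)
have [D D0 gap] : exists2 D, 0 < D & forall eta, `|eta| <= Z -> e <= `|eta - zeta| ->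
    F eta <= F zeta - D.
  pose K := [set eta : 'rV[R]_d | `|eta| <= Z] `&` [set eta | e <= `|eta - zeta|].
  have [K0|/nonemptyPn K0] := pselect (K !=set0); last first.
    exists 1 => // eta etaZ etae; have : K eta by split.
    by rewrite K0.
  have Kc : compact K.
    apply: compact_closedI; first exact: rV_ball_compact.
    rewrite (_ : mkset _ = (fun eta : 'rV[R]_d => `|eta - zeta|) @^-1` [set r : R | e <= r]) //.
    apply: closed_comp => [eta _|]; last exact: closed_ge.
    apply: (@continuous_comp _ _ _ (fun eta => eta - zeta)); last exact: norm_continuous.
    exact: (cvgB (@cvg_id _ (nbhs eta)) (@cvg_cst _ zeta _ (nbhs eta) (nbhs_filter eta))).
  have [|c cK cmax] := compact_EVT_max K0 Kc (f := F).
    by apply: continuous_subspaceT; exact: gain_continuous.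
  move: cK; rewrite inE => -[cZ ce]; exists (F zeta - F c); last first.
    by move=> eta etaZ etae; rewrite subKr; apply: cmax; rewrite inE; split.
  rewrite subr_gt0 lt_neqAle zmax andbT; apply/negP => /eqP Fc.
  have cm : maximizes x t p c by move=> eta; rewrite -/(F c) Fc; exact: zmax.
  by move: ce; rewrite /= (maximizer_unique zmax cm) subrr normr0 leNgt e0.
have N1 : \forall s \near (0 : R)^', `|s| < 1 by exact: (@dnbhs0_lt R R^o).
have Z1 : 0 < 2 * Z + 1 by rewrite ltr_wpDl // mulr_ge0.
have N2 : \forall s \near (0 : R)^', `|s| < D / (2 * Z + 1).
  by apply: (@dnbhs0_lt R R^o); rewrite divr_gt0.
near=> s.
have s0 : s != 0 by near: s; exact: nbhs_dnbhs_neq.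
have s1 : `|s| < 1 by near: s.
have sD : `|s| < D / (2 * Z + 1) by near: s.
have [|zs zsZ zsmax] := hZ x t (s *: ebasis j + p).
  rewrite addrC; apply: (le_trans (ler_normD _ _)); rewrite lerD2l normrZ.
  by rewrite -[leRHS]mul1r; apply: ler_pM; rewrite ?norm_ebasis_le1 // ltW.
rewrite /= (hamiltonian_maximizes zmax) (hamiltonian_maximizes zsmax).
have := zsmax zeta; rewrite !dotDl !dotZl !(dotC (ebasis j)) !dot_ebasis => I1.
have I2 := zmax zs.
have close : `|zs - zeta| <= e.
  rewrite leNgt; apply/negP => /ltW far; have := gap _ zsZ far; rewrite /F.
  rewrite ltr_pdivlMr // in sD.
  have A1 : `|s * (zeta 0 j - zs 0 j)| <= `|s| * (2 * Z).
    rewrite normrM ler_wpM2l // (le_trans (ler_normB _ _)) // mulr2n mulrDl mul1r.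
    by apply: lerD; apply: le_trans (coord_le_norm _ _) _.
  have A2 := normr_ge0 s; move: A1; rewrite ler_norml => /andP[A1 _].
  lra.
apply: le_trans close; apply: le_trans (coord_le_norm _ j).
set q := _^-1 *: _.
have Eq : s * q = dot p zs - L (x, t, zs) + s * zs 0 j - (dot p zeta - L (x, t, zeta)).
  rewrite (_ : q = s^-1 * (s * zs 0 j + dot p zs - L (x, t, zs)
    - (dot p zeta - L (x, t, zeta)))) // mulVKf //; lra.
rewrite -(@ler_pM2l _ `|s|) ?normr_gt0 // -!normrM.
rewrite !mxE !mulrBr Eq.
by rewrite ler0_norm ?ger0_norm; lra.
Unshelve. all: by end_near. Qed.

End Legendre.

(** * Quadratic test functions *)
Section Quadratic.
Context {R : realType} {d : nat}.
Implicit Types (x y : 'rV[R]_d) (s t : R).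

(** The difference quotient is A + h B. *)
Lemma is_derive_quadratic (V : normedModType R) (F : V -> R) (a v : V) (A B : R) :
  (forall h : R, F (h *: v + a) - F a = h * A + h ^+ 2 * B) -> is_derive a v F A.
Proof.
move=> FE.
suff C : (fun h => h^-1 *: ((F \o shift a) (h *: v) - F a)) @ 0^' --> A.
  by constructor; [apply/cvg_ex; exists A|apply: cvg_lim => //; exact: norm_hausdorff].
apply/cvgrPdist_le => e e0.
have B0 : 0 < `|B| + 1 by rewrite ltr_wpDl.
have N1 : \forall h \near (0 : R)^', `|h| < e / (`|B| + 1).
  by apply: (@dnbhs0_lt R R^o); rewrite divr_gt0.
near=> h.
have h0 : h != 0 by near: h; exact: nbhs_dnbhs_neq.
have he : `|h| < e / (`|B| + 1) by near: h.
rewrite /= FE (_ : _ *: _ = h^-1 * (h * A + h ^+ 2 * B)) //.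
rewrite expr2 -mulrA -mulrDr mulKf // opprD addNKr normrN normrM.
rewrite ltr_pdivlMr // in he; apply: le_trans (ltW he).
by rewrite ler_wpM2l // lerDl.
Unshelve. all: by end_near. Qed.

Definition quad (kappa : R) y s (z : 'rV[R]_d * R) : R :=
  kappa * (dot (z.1 - y) (z.1 - y) + (z.2 - s) ^+ 2).

Lemma is_derive_quad kappa y s x t v r :
  is_derive ((x, t) : 'rV[R]_d * R) (v, r) (quad kappa y s)
    (2 * kappa * (dot (x - y) v + (t - s) * r)).
Proof.
apply: (@is_derive_quadratic _ _ _ _ _ (kappa * (dot v v + r ^+ 2))) => h.
rewrite /quad /= -!addrA !(dotDl, dotDr, dotZl, dotZr) [h *: r]/GRing.scale /=.
rewrite !(dotC v); ring.
Qed.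

Lemma quad_C1 kappa y s : C1 (quad kappa y s).
Proof.
move=> [v r]; split => [[x t]|]; first by case: (is_derive_quad kappa y s x t v r).
have E : (fun z => 'D_(v, r) (quad kappa y s) z)
    = (fun z : 'rV[R]_d * R => 2 * kappa * (dot (z.1 - y) v + (z.2 - s) * r)).
  by apply/funext => -[x t]; case: (is_derive_quad kappa y s x t v r).
rewrite E => -[x t]; apply/cvgrPdist_le => e e0.
pose C := `|2 * kappa| * (d%:R * `|v| + `|r|) + 1.
have C0 : 0 < C by rewrite ltr_wpDl // mulr_ge0 // addr_ge0 // mulr_ge0.
have N := near_dist_lt (x, t) (divr_gt0 e0 C0).
near=> z; have xe : `|(x, t) - z| < e / C by near: z.
move: (z) xe => [x' t'] xe /=.
rewrite -mulrBr normrM (_ : _ - _ = dot (x - x') v + (t - t') * r); last first.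
  by rewrite !dotBl; ring.
rewrite ltr_pdivlMr // in xe; apply: le_trans (ltW xe).
have n1 : `|x - x'| <= `|(x, t) - (x', t')| by rewrite [leRHS]/Num.norm /= le_max lexx.
have n2 : `|t - t'| <= `|(x, t) - (x', t')| by rewrite [leRHS]/Num.norm /= le_max lexx orbT.
set n := `|(x, t) - _| in n1 n2 *.
rewrite /C mulrDr mulr1 mulrCA; apply: ler_wpDr; first exact: le_trans n1.
rewrite ler_wpM2l // mulrDr (le_trans (ler_normD _ _)) // lerD //.
  by rewrite (le_trans (norm_dot_le _ _)) // (mulrCA n) ler_wpM2l // ler_wpM2r.
by rewrite normrM ler_wpM2r.
Unshelve. all: by end_near. Qed.

Lemma quad_continuous kappa y s : continuous (quad kappa y s).
Proof.
move=> z; have Fz := nbhs_filter z.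
have Bj (j : 'I_d) : (fun w : 'rV[R]_d * R => w.1 0 j - y 0 j) @ z --> z.1 0 j - y 0 j.
  have C : (fun w : 'rV[R]_d * R => w.1 0 j) @ z --> z.1 0 j.
    exact: (cvg_comp _ _ (@cvg_fst _ _ (nbhs z.1) (nbhs z.2) _) (@coord_continuous R 1 d 0 j z.1)).
  exact: (cvgB C (@cvg_cst _ (y 0 j) _ (nbhs z) Fz)).
have T : (fun w : 'rV[R]_d * R => w.2 - s) @ z --> z.2 - s.
  have C : (fun w : 'rV[R]_d * R => w.2) @ z --> z.2.
    exact: (@cvg_snd _ _ (nbhs z.1) (nbhs z.2) _).
  exact: (cvgB C (@cvg_cst _ s _ (nbhs z) Fz)).
have S : (fun w : 'rV[R]_d * R => \sum_j (w.1 0 j - y 0 j) * (w.1 0 j - y 0 j)) @ z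
    --> \sum_j (z.1 0 j - y 0 j) * (z.1 0 j - y 0 j).
  apply: (@cvg_big _ _ _ _ _ (@add_continuous _) _ (nbhs z)) => j _.
  exact: (cvgM (Bj j) (Bj j)).
have D := @cvgMl_tmp R _ (nbhs z) Fz _ kappa _ (cvgD S (cvgM T T)).
have E : quad kappa y s = (fun z : 'rV[R]_d * R => kappa *
    (\sum_j (z.1 0 j - y 0 j) * (z.1 0 j - y 0 j) + (z.2 - s) * (z.2 - s))).
  apply/funext => w; rewrite /quad expr2; congr (_ * (_ + _)).
  by apply: eq_bigr => j _; rewrite !mxE.
rewrite E; exact: D.
Qed.

Lemma sqr_norm_le_dot x : `|x| ^+ 2 <= dot x x.
Proof.
have x0 : 0 <= dot x x by apply: sumr_ge0 => j _; rewrite -expr2 sqr_ge0.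
by rewrite -(sqr_sqrtr x0) lerXn2r ?nnegrE ?sqrtr_ge0 //; exact: norm_le_enorm.
Qed.

(** Where the penalty exceeds twice the bound of u, the value lies below that at
    the centre, so that the maximum over a compact set is global. *)
Lemma penalized_max (u : 'rV[R]_d * R -> R) B kappa y s : continuous u ->
  (forall z, `|u z| <= B) -> 0 < kappa ->
  exists z, forall z', u z' - quad kappa y s z' <= u z - quad kappa y s z.
Proof.
move=> uc uB kappa0.
have B0 : 0 <= B := le_trans (normr_ge0 _) (uB (0, 0)).
(* At distance rho the penalty is at least 2 B. *)
pose rho := 2 * B / kappa + 1.
have rho1 : 1 <= rho by rewrite lerDr divr_ge0 ?mulr_ge0 // ltW.
have rhoB : 2 * B <= kappa * rho ^+ 2.
  rewrite (mulrC kappa) -ler_pdivrMr //; apply: (@le_trans _ _ rho); first by rewrite lerDl.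
  by rewrite expr2 ler_peMr // (le_trans _ rho1).
pose K := [set x : 'rV[R]_d | `|x| <= rho + `|y|] `*` [set t : R | `|t| <= rho + `|s|].
have Kys : K (y, s) by split; rewrite /= lerDr (le_trans _ rho1).
have Kc : compact K by apply: compact_setX; [exact: rV_ball_compact|exact: interval_ball_compact].
have [||z zK zmax] := @compact_EVT_max _ R (fun z => u z - quad kappa y s z) K _ Kc.
- by exists (y, s).
- apply: continuous_subspaceT => z.
  exact: (cvgB (uc z) (@quad_continuous kappa y s z)).
exists z => z'; have [z'K|z'K] := pselect (K z'); first by apply: zmax; rewrite inE.
have := zmax (y, s); rewrite inE => /(_ Kys); apply: le_trans.
have -> : quad kappa y s (y, s) = 0 by rewrite /quad /= !subrr dot0r expr0n addr0 mulr0.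
suff : kappa * rho ^+ 2 <= quad kappa y s z'.
  have := uB z'; have := uB (y, s); rewrite !ler_norml => /andP[? ?] /andP[? ?]; lra.
rewrite ler_wpM2l ?(ltW kappa0) //.
have rho0 : 0 <= rho by apply: le_trans rho1.
have [xrho|xrho] := leP (`|z'.1|) (rho + `|y|).
  have [trho|trho] := leP (`|z'.2|) (rho + `|s|); first by case: z'K; split.
  have : rho <= `|z'.2 - s|.
    by have := ler_normD (z'.2 - s) s; rewrite subrK; lra.
  move=> H; apply: ler_wpDl; first exact: le_trans (sqr_norm_le_dot _).
  by rewrite -[leRHS]real_normK ?num_real // lerXn2r ?nnegrE.
have : rho <= `|z'.1 - y|.
  by have := ler_normD (z'.1 - y) y; rewrite subrK; lra.
move=> H; apply: ler_wpDr; first exact: sqr_ge0.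
by apply: le_trans (sqr_norm_le_dot _); rewrite lerXn2r ?nnegrE.
Qed.

Lemma hj_operator_quad L c kappa y s x t :
  hj_operator L c (quad kappa y s) x t
  = 2 * kappa * (t - s) + hamiltonian L x t (c + (2 * kappa) *: (x - y)).
Proof.
have D1 : is_derive t (1 : R) (fun r => quad kappa y s (x, r)) (2 * kappa * (t - s)).
  apply: (@is_derive_quadratic _ _ _ _ _ kappa) => h.
  by rewrite /quad /= [h *: _]mulr1; ring.
have Dj j : is_derive x (ebasis j) (fun y' => quad kappa y s (y', t)) (2 * kappa * (x 0 j - y 0 j)).
  apply: (@is_derive_quadratic _ _ _ _ _ kappa) => h.
  rewrite /quad /= -!addrA !(dotDl, dotDr, dotZl, dotZr) !(dotC (ebasis j)) !dot_ebasis.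
  by rewrite !mxE !eqxx /=; ring.
rewrite /hj_operator; case: D1 => _ ->.
have -> // : gradient (fun y' => quad kappa y s (y', t)) x = (2 * kappa) *: (x - y).
by apply/rowP => j; rewrite !mxE; case: (Dj j).
Qed.

End Quadratic.

(** * Viscosity solutions tested by quadratics *)
Section Viscosity.
Context {R : realType} {d : nat}.
Implicit Types (x y : 'rV[R]_d) (s t : R).

Lemma periodic_max (u : 'rV[R]_d * R -> R) : continuous u -> Defs.periodic u ->
  exists z, forall z', u z' <= u z.
Proof.
move=> uc uper; pose K := [set x : 'rV[R]_d | `|x| <= 1] `*` [set t : R | `|t| <= 1].
have Kc : compact K by apply: compact_setX; [exact: rV_ball_compact|exact: interval_ball_compact].
have [||z _ zmax] := @compact_EVT_max _ R u K _ Kc.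
- by exists (0, 0); rewrite /K /= !normr0 ler01.
- exact: continuous_subspaceT.
exists z => -[x t]; have [y [s [xy ts]]] := translate_to_cube x t.
by rewrite -(uper y s); apply: zmax; rewrite inE.
Qed.

Lemma periodic_opp (u : 'rV[R]_d * R -> R) : Defs.periodic u -> Defs.periodic (fun z => - u z).
Proof. by move=> uper z s x t; rewrite uper. Qed.

Lemma continuous_opp (u : 'rV[R]_d * R -> R) : continuous u -> continuous (fun z => - u z).
Proof. by move=> uc z; exact: cvgN (uc z). Qed.

Lemma continuous_periodic_bounded (u : 'rV[R]_d * R -> R) : continuous u -> Defs.periodic u ->
  exists B, forall z, `|u z| <= B.
Proof.
move=> uc uper; have [z1 M1] := periodic_max uc uper.
have [z2 M2] := periodic_max (continuous_opp uc) (periodic_opp uper).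
exists (`|u z1| + `|u z2|) => z; have := M1 z; have := M2 z.
have := ler_norm (u z1); have := ler_norm (- u z2); rewrite normrN.
have := normr_ge0 (u z1); have := normr_ge0 (u z2).
by rewrite ler_norml => ? ? ? ? ? ?; apply/andP; split; lra.
Qed.

Variables (L : 'rV[R]_d * R * 'rV[R]_d -> R) (c : 'rV[R]_d) (a : R).
Variables (v : 'rV[R]_d * R -> R) (hv : viscosity_solution L c a v).

Lemma viscosity_sub_quad kappa y s x t :
  (forall z, v z - quad kappa y s z <= v (x, t) - quad kappa y s (x, t)) ->
  2 * kappa * (t - s) + hamiltonian L x t (c + (2 * kappa) *: (x - y)) <= a.
Proof.
move=> vmax; rewrite -hj_operator_quad; apply: (viscosity_sub hv).
  exact: quad_C1.
by near do exact: vmax.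
Unshelve. all: by end_near. Qed.

Lemma viscosity_super_quad kappa y s x t :
  (forall z, v (x, t) - quad kappa y s (x, t) <= v z - quad kappa y s z) ->
  a <= 2 * kappa * (t - s) + hamiltonian L x t (c + (2 * kappa) *: (x - y)).
Proof.
move=> vmin; rewrite -hj_operator_quad; apply: (viscosity_super hv).
  exact: quad_C1.
by near do exact: vmin.
Unshelve. all: by end_near. Qed.

(** Constants are admissible test functions at a maximum and at a minimum of v. *)
Lemma viscosity_value_bounded C : (forall x t, `|hamiltonian L x t c| <= C) -> `|a| <= C.
Proof.
move=> HC.
have vc := viscosity_continuous hv; have vper := viscosity_periodic hv.
have quad0 z : quad 0 (0 : 'rV[R]_d) 0 z = 0 by rewrite /quad mul0r.
have [[x1 t1] M1] := periodic_max vc vper.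
have [[x2 t2] M2] := periodic_max (continuous_opp vc) (periodic_opp vper).
have := @viscosity_sub_quad 0 0 0 x1 t1.
rewrite mulr0 mul0r scale0r addr0 add0r => I1.
have := @viscosity_super_quad 0 0 0 x2 t2.
rewrite mulr0 mul0r scale0r addr0 add0r => I2.
rewrite ler_norml; apply/andP; split.
  apply: le_trans (I1 _) => [|z]; last by rewrite !quad0 !subr0.
  by have := HC x1 t1; rewrite ler_norml => /andP[].
apply: le_trans (I2 _) _ => [z|]; first by rewrite !quad0 !subr0; have := M2 z; rewrite lerN2.
by have := HC x2 t2; rewrite ler_norml => /andP[].
Qed.

End Viscosity.

(** * Doubling of variables between the torus and the grid *)
Section Doubling.
Context {R : realType} {d : nat}.
Implicit Types (x y : 'rV[R]_d) (s t : R) (m z : 'rV[int]_d) (N K k : nat).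

Lemma in_dual_grid_translate N K m z k l :
  in_dual_grid (k + 2 * K * l) (m + z *+ (2 * N)) = in_dual_grid k m.
Proof.
rewrite /in_dual_grid oddD -mulnA oddM /= addbF; congr (~~ _ (+) _).
rewrite /even_pt.
have -> : \sum_(j < d) (m + z *+ (2 * N)) 0 j
    = \sum_(j < d) m 0 j + 2 * \sum_(j < d) z 0 j *+ N.
  rewrite mulr_sumr -big_split; apply: eq_bigr => j _ /=.
  by rewrite mxE mulmxnE mulrnA mulrnAr mulr_natl.
by rewrite rpredDr // dvdz_mulr.
Qed.

Lemma mesh_gt0 N : (0 < N)%N -> 0 < mesh N :> R.
Proof. by move=> N0; rewrite invr_gt0 mulr_gt0 // ltr0n. Qed.

Lemma mesh_period N : (0 < N)%N -> mesh N * (2 * N)%:R = 1 :> R.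
Proof. by move=> N0; rewrite /mesh -natrM mulVf // pnatr_eq0 -lt0n muln_gt0. Qed.

Lemma xpt_translate N m z : (0 < N)%N ->
  xpt N (m + z *+ (2 * N)) = xpt N m + map_mx intr z :> 'rV[R]_d.
Proof.
move=> N0; apply/rowP => j; rewrite !mxE mulmxnE intrD mulrDr; congr (_ + _).
by rewrite rmorphMn -mulr_natr /= mulrCA mesh_period ?mulr1.
Qed.

Lemma tpt_translate K k l : (0 < K)%N ->
  tpt K (k + 2 * K * l) = tpt K k + (l%:Z)%:~R :> R.
Proof. by move=> K0; rewrite /tpt natrD mulrDr natrM mulrA mesh_period ?mul1r. Qed.

Lemma grid_reduce N K k m : (0 < N)%N -> (0 < K)%N ->
  exists (i : 'I_(2 * K)) (f : {ffun 'I_d -> 'I_(2 * N)}) l z,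
    k = (i + 2 * K * l)%N /\ m = \row_j (f j)%:Z + z *+ (2 * N).
Proof.
move=> N0 K0; have N20 : (0 < 2 * N)%N by rewrite muln_gt0.
have K20 : (0 < 2 * K)%N by rewrite muln_gt0.
pose r (j : 'I_d) := modz (m 0 j) (2 * N)%N.
have b j : (`|r j| < 2 * N)%N.
  have := ltz_pmod (m 0 j) (N20 : 0 < (2 * N)%N%:Z).
  by have := modz_ge0 (m 0 j) (lt0r_neq0 (N20 : 0 < (2 * N)%N%:Z)); rewrite -/(r j); lia.
exists (Ordinal (ltn_pmod k K20)), [ffun j => Ordinal (b j)], (k %/ (2 * K))%N.
exists (\row_j divz (m 0 j) (2 * N)%N); split.
  by rewrite /= addnC mulnC -divn_eq.
apply/rowP => j; rewrite !mxE mulmxnE !mxE ffunE /=.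
rewrite /r gez0_abs ?modz_ge0 ?lt0r_neq0 //.
by rewrite {1}(divz_eq (m 0 j) (2 * N)%N%:Z) addrC -mulr_natr natz.
Qed.

(** After subtraction of a quadratic penalty, the difference between a periodic
    continuous function and a periodic grid function has a global maximum: the
    penalty confines (x, t) to a ball around the grid point, and the grid points
    are finitely many up to translation by a period. *)
Lemma doubling_max N K (u : 'rV[R]_d * R -> R) (g : nat -> 'rV[int]_d -> R) kappa :
  (0 < N)%N -> (0 < K)%N -> continuous u -> Defs.periodic u -> 0 < kappa ->
  (forall k m z l, in_dual_grid k m -> g (k + 2 * K * l)%N (m + z *+ (2 * N)) = g k m) ->
  exists x t k m, in_dual_grid k.+1 m /\
    forall x' t' k' m', in_dual_grid k' m' ->
      u (x', t') + g k' m' - quad kappa (xpt N m') (tpt K k') (x', t')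
      <= u (x, t) + g k.+1 m - quad kappa (xpt N m) (tpt K k.+1) (x, t).
Proof.
move=> N0 K0 uc uper kappa0 gper.
have N20 : (0 < 2 * N)%N by rewrite muln_gt0.
have K21 : (1 < 2 * K)%N by rewrite mul2n -addnn; lia.
have [B uB] := continuous_periodic_bounded uc uper.
have [Z Zmax] := choice (fun km : nat * 'rV[int]_d =>
  penalized_max (xpt N km.2) (tpt K km.1) uc uB kappa0).
pose val k m (xt : 'rV[R]_d * R) := u xt + g k m - quad kappa (xpt N m) (tpt K k) xt.
have valT k m x t l z : in_dual_grid k m ->
    val (k + 2 * K * l)%N (m + z *+ (2 * N)) (x + map_mx intr z, t + (l%:Z)%:~R) = val k m (x, t).
  move=> km; rewrite /val uper gper //; congr (_ - _).
  by rewrite /quad /= xpt_translate // tpt_translate // !opprD !(addrACA _ _ (- _)) !subrr !addr0.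
pose pt (i : 'I_(2 * K) * {ffun 'I_d -> 'I_(2 * N)}) : 'rV[int]_d := \row_j (i.2 j)%:Z.
pose top (i : 'I_(2 * K) * {ffun 'I_d -> 'I_(2 * N)}) := val i.1 (pt i) (Z (nat_of_ord i.1, pt i)).
pose i0 : 'I_(2 * K) * {ffun 'I_d -> 'I_(2 * N)} := (Ordinal K21, [ffun=> Ordinal N20]).
have i0P : in_dual_grid i0.1 (pt i0).
  rewrite /in_dual_grid /odd_pt /even_pt big1 ?dvdz0 // => j _.
  by rewrite mxE ffunE.
have [i iP imax] := @arg_maxP _ _ _ i0 (fun i => in_dual_grid i.1 (pt i)) top i0P.
have [x [t Zi]] : exists x t, Z (nat_of_ord i.1, pt i) = (x, t) by case: (Z _) => x t; exists x, t.
(* The maximum is moved forward by one period, so that its time is positive. *)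
exists x, (t + (1%N%:Z)%:~R), (i.1 + 2 * K - 1)%N, (pt i).
have kE : (i.1 + 2 * K - 1).+1 = (i.1 + 2 * K * 1)%N by lia.
have mE : pt i = pt i + 0 *+ (2 * N) by rewrite mul0rn addr0.
split; first by rewrite kE mE in_dual_grid_translate.
move=> x' t' k' m' dual'; rewrite -!/(val _ _ _).
have -> : val (i.1 + 2 * K - 1).+1 (pt i) (x, t + (1%N%:Z)%:~R) = top i.
  rewrite kE {1}mE (_ : x = x + map_mx intr 0) ?valT ?/top ?Zi //.
  by rewrite map_mx0 addr0.
have [k0 [f [l [z [kE' mE']]]]] := grid_reduce k' m' N0 K0.
have dual0 : in_dual_grid k0 (pt (k0, f)).
  by rewrite -(in_dual_grid_translate N K _ z _ l) -kE' -mE'.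
apply: le_trans (imax (k0, f) dual0).
rewrite -(subrK (map_mx intr z) x') -(subrK ((l%:Z)%:~R) t') kE' mE' valT //.
have := Zmax (nat_of_ord k0, pt (k0, f)) (x' - map_mx intr z, t' - l%:Z%:~R).
rewrite /top /val /=; lra.
Qed.

End Doubling.

(** * Averages and difference quotients on the staggered grid *)
Section Grid.
Context {R : realType} {d : nat}.
Implicit Types (m n z : 'rV[int]_d) (N K k l : nat) (o : 'I_d * bool).
Implicit Types (u : 'rV[int]_d -> R).

Lemma step_opp j b : step (j, ~~ b) = - step (j, b) :> 'rV[int]_d.
Proof. by case: b; rewrite /step /= expr0 expr1 scaleN1r ?opprK scale1r. Qed.

Lemma even_pt_step m o : even_pt (m + step o) = ~~ even_pt m.
Proof.
case: o => j b; rewrite /even_pt.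
have -> : \sum_(i < d) (m + step (j, b)) 0 i = \sum_(i < d) m 0 i + (-1) ^+ b.
  under eq_bigr do rewrite mxE.
  rewrite big_split /=; congr (_ + _); rewrite (bigD1 j) //= big1 => [|i ij].
    by rewrite !mxE !eqxx mulr1 addr0.
  by rewrite !mxE (negbTE ij) andbF mulr0.
by case: b => /=; move: (\sum_(i < d) _) => S; lia.
Qed.

Lemma even_pt_stepN m o : even_pt (m - step o) = ~~ even_pt m.
Proof. by case: o => j b; rewrite -step_opp even_pt_step. Qed.

Lemma in_dual_gridS k m : in_dual_grid k.+1 m = in_grid k m.
Proof. by rewrite /in_dual_grid /in_grid /odd_pt /=; case: even_pt; case: (odd k). Qed.

Lemma in_gridS k m : in_grid k.+1 m = in_dual_grid k m.
Proof. by rewrite /in_dual_grid /in_grid /odd_pt /=; case: even_pt; case: (odd k). Qed.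

Lemma in_dual_grid_step k m o : in_dual_grid k (m + step o) = in_grid k m.
Proof. by rewrite /in_dual_grid /odd_pt even_pt_step negbK. Qed.

Lemma in_dual_grid_stepN k m o : in_dual_grid k (m - step o) = in_grid k m.
Proof. by rewrite /in_dual_grid /odd_pt even_pt_stepN negbK. Qed.

Lemma in_grid_step k m o : in_grid k (m + step o) = in_dual_grid k m.
Proof. by rewrite -in_dual_gridS in_dual_grid_step in_gridS. Qed.

Lemma in_grid_stepN k m o : in_grid k (m - step o) = in_dual_grid k m.
Proof. by rewrite -in_dual_gridS in_dual_grid_stepN in_gridS. Qed.

Lemma in_dual_grid_walk k m o i :
  in_dual_grid (k + i) (m - step o *+ i) = in_dual_grid k m.
Proof.
elim: i => [|i IH]; first by rewrite addn0 mulr0n subr0.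
by rewrite addnS mulrSr opprD addrA in_dual_gridS in_grid_stepN.
Qed.

Lemma eq_average_shift u u' m m' b : (0 < d)%N ->
  (forall o, u' (m' + step o) = u (m + step o) + b) ->
  average u' m' = average u m + b.
Proof.
move=> d0 E; rewrite /average (eq_bigr _ (fun o _ => E o)) big_split /= mulrDr.
have -> : \sum_(o : 'I_d * bool) b = 2 * d%:R * b.
  by rewrite sumr_const card_prod card_ord card_bool mulnC -natrM mulr_natl.
by rewrite mulKf // mulf_neq0 // pnatr_eq0 -?lt0n.
Qed.

Lemma eq_Dx_shift N u u' m m' b :
  (forall o, u' (m' + step o) = u (m + step o) + b) -> Dx N u' m' = Dx N u m.
Proof.
by move=> E; apply/rowP => j; rewrite !mxE !E opprD addrACA subrr addr0.
Qed.

Lemma average_le u m B : (0 < d)%N -> (forall o, u (m + step o) <= B) ->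
  average u m <= B.
Proof.
move=> d0 uB; have <- : average (fun=> 0) m + B = B.
  by rewrite /average big1 // mulr0 add0r.
rewrite -(@eq_average_shift (fun=> 0) (fun=> B) m m B) // => [|o]; last by rewrite add0r.
rewrite /average ler_pM2l ?invr_gt0 ?mulr_gt0 ?ltr0n //.
by apply: ler_sum => o _.
Qed.

Lemma averageN u m : average (fun n => - u n) m = - average u m.
Proof. by rewrite /average sumrN mulrN. Qed.

Lemma average_ge u m B : (0 < d)%N -> (forall o, B <= u (m + step o)) ->
  B <= average u m.
Proof.
by move=> d0 uB; rewrite -lerN2 -averageN; apply: average_le => // o; rewrite lerN2.
Qed.

(** The increments p.(step o) cancel over opposite steps. *)
Lemma sum_dot_step (p : 'rV[R]_d) : \sum_o dot p (map_mx intr (step o)) = 0.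
Proof.
rewrite -(pair_bigA _ (fun j b => dot p (map_mx intr (step (j, b))))) big1 //= => j _.
by rewrite big_bool /= (step_opp j false) map_mxN -dotDr addNr dot0r.
Qed.

(** Doubling against the zero function: the maximum over (x, t) of minus the
    penalty is attained at the grid point itself. *)
Lemma grid_max N K (g : nat -> 'rV[int]_d -> R) : (0 < N)%N -> (0 < K)%N ->
  (forall k m z l, in_dual_grid k m -> g (k + 2 * K * l)%N (m + z *+ (2 * N)) = g k m) ->
  exists k m, in_dual_grid k.+1 m /\
    forall k' m', in_dual_grid k' m' -> g k' m' <= g k.+1 m.
Proof.
move=> N0 K0 gper.
have u0c : continuous (fun _ : 'rV[R]_d * R => 0 : R).
  by move=> z; exact: (@cvg_cst _ 0 _ (nbhs z) (nbhs_filter z)).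
have [x [t [k [m [km gmax]]]]] := doubling_max N0 K0 u0c (fun _ _ _ _ => erefl) ltr01 gper.
exists k, m; split => // k' m' dual'.
have := gmax (xpt N m') (tpt K k') _ _ dual'.
have -> : quad 1 (xpt N m') (tpt K k') (xpt N m', tpt K k') = 0 :> R.
  by rewrite /quad /= !subrr dot0r expr0n addr0 mulr0.
rewrite subr0 !add0r => /le_trans -> //; rewrite gerBl /quad mul1r.
by rewrite addr_ge0 ?sqr_ge0 // (le_trans _ (sqr_norm_le_dot _)) // sqr_ge0.
Qed.

End Grid.

(** * Periodic solutions of the scheme *)
Section CellSolution.
Context {R : realType} {d : nat}.
Hypothesis d_gt0 : (0 < d)%N.
Implicit Types (m n z : 'rV[int]_d) (N K k l : nat) (o : 'I_d * bool).
Implicit Types (u w : 'rV[int]_d -> R).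
Variables (L : 'rV[R]_d * R * 'rV[R]_d -> R) (hL : lagrangian L).

Lemma hamiltonian_space_periodic x t p z :
  hamiltonian L (x + map_mx intr z) t p = hamiltonian L x t p.
Proof. by have := hamiltonian_periodic hL z 0 x t p; rewrite addr0. Qed.

Lemma hamiltonian_time_periodic x t p (s : int) :
  hamiltonian L x (t + s%:~R) p = hamiltonian L x t p.
Proof. by have := hamiltonian_periodic hL 0 s x t p; rewrite map_mx0 addr0. Qed.

Lemma Dx_step N u m o : (0 < N)%N ->
  `|u (m + step o) - u (m - step o)| <= 2 * mesh N * `|Dx N u m|.
Proof.
move=> N0; have h0 := @mesh_gt0 R N N0; case: o => j b.
have -> : `|u (m + step (j, b)) - u (m - step (j, b))| = 2 * mesh N * `|Dx N u m 0 j|.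
  rewrite mxE normrM normfV (gtr0_norm (_ : 0 < 2 * mesh N)) ?mulr_gt0 //.
  rewrite mulrC divfK ?mulf_neq0 ?gt_eqF //.
  by case: b; rewrite (step_opp j false) ?opprK // distrC.
by rewrite ler_pM2l ?mulr_gt0 // coord_le_norm.
Qed.

(** The periods form a subgroup, and it contains the basis. *)
Lemma X_translate r N w m z : X r N w -> odd_pt m -> w (m + z *+ (2 * N)) = w m.
Proof.
move=> [wper _]; pose S y := forall m, odd_pt m -> w (m + y *+ (2 * N)) = w m.
have odd_tr m' y : odd_pt m' -> odd_pt (m' + y *+ (2 * N)).
  by have := in_dual_grid_translate N 0 m' y 0 0; rewrite /in_dual_grid /= !addbF => ->.
have SD y y' : S y -> S y' -> S (y + y').
  by move=> Sy Sy' m' om; rewrite mulrnDl addrA Sy' ?Sy //; exact: odd_tr.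
have SN y : S y -> S (- y).
  move=> Sy m' om; rewrite -[in RHS](subrK (y *+ (2 * N)) m') -mulNrn Sy //.
  exact: odd_tr.
have S0 : S 0 by move=> m' _; rewrite mul0rn addr0.
suff Sz : S z by exact: Sz.
rewrite [z]row_sum_delta; apply: (big_ind S) => // j _.
have Se : S (delta_mx 0 j) by move=> m' om; exact: wper.
have Sn (i : nat) : S (i%:Z *: delta_mx 0 j).
  elim: i => [|i IH]; first by rewrite scale0r.
  by rewrite intS scalerDl scale1r; exact: SD.
by case: (z 0 j) => i //; rewrite NegzE scaleNr; exact: SN.
Qed.

(** A space-time periodic solution g of the scheme with right-hand side a; it is
    obtained from a fixed point by compensating the drift in time. *)
Record cell_solution c a N K M (g : nat -> 'rV[int]_d -> R) : Prop := CellSolution {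
  cell_periodic : forall k m z l, in_dual_grid k m ->
    g (k + 2 * K * l)%N (m + z *+ (2 * N)) = g k m ;
  cell_scheme : forall k m, in_grid k m ->
    g k.+1 m = average (g k) m
      - mesh K * hamiltonian L (xpt N m) (tpt K k) (c + Dx N (g k) m) + mesh K * a ;
  cell_speed : forall k m, in_grid k m ->
    `|hamiltonian_p L (xpt N m) (tpt K k) (c + Dx N (g k) m)| <= M }.

Lemma solmap_space_periodic r N K c w k m z : (0 < N)%N -> X r N w ->
  in_dual_grid k m -> solmap L N K c w k (m + z *+ (2 * N)) = solmap L N K c w k m.
Proof.
move=> N0 wX; elim: k m => [|k IH] m km.
  by apply: (X_translate _ wX); move: km; rewrite /in_dual_grid addbF.
have E o : solmap L N K c w k (m + z *+ (2 * N) + step o)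
    = solmap L N K c w k (m + step o) + 0.
  by rewrite addrAC IH ?addr0 // in_dual_grid_step -in_dual_gridS.
rewrite /= (eq_average_shift d_gt0 E) (eq_Dx_shift N E) addr0.
by rewrite xpt_translate // hamiltonian_space_periodic.
Qed.

Lemma solmap_time_periodic N K c w a k m : (0 < K)%N ->
  (forall m, odd_pt m -> solmap L N K c w (2 * K)%N m + a = w m) ->
  in_dual_grid k m -> solmap L N K c w (k + 2 * K) m = solmap L N K c w k m - a.
Proof.
move=> K0 wfix; elim: k m => [|k IH] m km.
  by rewrite add0n /= -wfix ?addrK //; move: km; rewrite /in_dual_grid addbF.
have E o : solmap L N K c w (k + 2 * K) (m + step o)
    = solmap L N K c w k (m + step o) - a.
  by rewrite IH // in_dual_grid_step -in_dual_gridS.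
rewrite addSn /= (eq_average_shift d_gt0 E) (eq_Dx_shift N E) addrAC.
congr (_ - _ * _ - _); rewrite -[(2 * K)%N]muln1 tpt_translate //.
exact: hamiltonian_time_periodic.
Qed.

Lemma cell_solution_solmap r lambda1 P N K c w a : (0 < N)%N -> (0 < K)%N ->
  standing P r lambda1 L N K -> P c -> X r N w ->
  (forall m, odd_pt m -> solmap L N K c w (2 * K)%N m + a = w m) ->
  cell_solution c a N K (d%:R * lambda1)^-1
    (fun k m => solmap L N K c w k m + a * tpt K k).
Proof.
move=> N0 K0 st Pc wX wfix; set v := solmap L N K c w.
have DxE k m : Dx N (fun m => v k m + a * tpt K k) m = Dx N (v k) m.
  exact: (@eq_Dx_shift _ _ N (v k) _ m m (a * tpt K k)).
split => [k m z l km|k m km|k m km].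
- have kl : in_dual_grid (k + 2 * K * l) m.
    by rewrite -(in_dual_grid_translate N K m 0 k l) mul0rn addr0 in km.
  rewrite /v (solmap_space_periodic _ _ _ N0 wX) // -/v.
  elim: l kl => [|l IH] kl; first by rewrite muln0 addn0.
  have kl' : in_dual_grid (k + 2 * K * l) m.
    by rewrite -(in_dual_grid_translate N K m 0 k l) mul0rn addr0 in km.
  have kE : (k + 2 * K * l.+1)%N = (k + 2 * K * l + 2 * K * 1)%N by lia.
  have vE : v (k + 2 * K * l.+1)%N m = v (k + 2 * K * l)%N m - a.
    by rewrite kE muln1; exact: solmap_time_periodic K0 wfix kl'.
  by rewrite vE kE tpt_translate // mulrDr mulr1 -(IH kl'); ring.
- rewrite DxE (@eq_average_shift _ _ (v k) _ m m (a * tpt K k)) //.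
  rewrite {1}/v /= -/v /tpt -natr1; ring.
- rewrite DxE; exact: (standing_speed st).
Qed.

Section Estimates.
Variables (c : 'rV[R]_d) (a : R) (N K : nat) (M : R) (g : nat -> 'rV[int]_d -> R).
Hypotheses (N_gt0 : (0 < N)%N) (K_gt0 : (0 < K)%N).
Hypothesis gcell : cell_solution c a N K M g.

Lemma cell_min : exists k m, in_dual_grid k.+1 m /\
  forall k' m', in_dual_grid k' m' -> g k.+1 m <= g k' m'.
Proof.
have [|k [m [km H]]] := @grid_max R d N K (fun k m => - g k m) N_gt0 K_gt0.
  by move=> k m z l km; rewrite (cell_periodic gcell).
by exists k, m; split => // k' m' ?; rewrite -lerN2 H.
Qed.

(** Bounds for a are read off the scheme at a maximum and at a minimum of g. *)
Lemma cell_value_bounded B :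
  (forall k m, in_grid k m ->
    `|hamiltonian L (xpt N m) (tpt K k) (c + Dx N (g k) m)| <= B) -> `|a| <= B.
Proof.
move=> HB; have t0 := @mesh_gt0 R K K_gt0.
have [k [m [km gmax]]] := grid_max N_gt0 K_gt0 (cell_periodic gcell).
have [k' [m' [km' gmin]]] := cell_min.
have kmg : in_grid k m by rewrite -in_dual_gridS.
have kmg' : in_grid k' m' by rewrite -in_dual_gridS.
have A : average (g k) m <= g k.+1 m.
  by apply: average_le => // o; apply: gmax; rewrite in_dual_grid_step.
have A' : g k'.+1 m' <= average (g k') m'.
  by apply: average_ge => // o; apply: gmin; rewrite in_dual_grid_step.
rewrite (cell_scheme gcell kmg) in A; rewrite (cell_scheme gcell kmg') in A'.
have Ba : mesh K * hamiltonian L (xpt N m) (tpt K k) (c + Dx N (g k) m) <= mesh K * a by lra.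
have aB : mesh K * a <= mesh K * hamiltonian L (xpt N m') (tpt K k') (c + Dx N (g k') m') by lra.
rewrite !ler_pM2l // in Ba aB.
have := HB k m kmg; have := HB k' m' kmg'; rewrite !ler_norml => /andP[_ ?] /andP[? _].
by apply/andP; split; [apply: le_trans Ba|apply: le_trans aB _].
Qed.

(** The discrete gradient only compares points two steps apart, so it does not
    control the differences between neighbours of a common point. One step of the
    scheme averages over neighbours: in the difference of two such averages the
    common neighbour cancels, which makes the largest difference contract; time
    periodicity then bounds it. *)
Lemma cell_neighbours B r : 0 <= B -> 0 <= r ->
  (forall k m, in_grid k m ->
    `|hamiltonian L (xpt N m) (tpt K k) (c + Dx N (g k) m)| <= B) ->
  (forall k m, in_grid k m -> `|Dx N (g k) m| <= r) ->
  forall k m o o', in_grid k m ->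
    `|g k (m + step o) - g k (m + step o')| <= 2 * d%:R * (4 * mesh N * r + 2 * mesh K * B).
Proof.
move=> B0 r0 HB gr.
have h0 := @mesh_gt0 R N N_gt0; have t0 := @mesh_gt0 R K K_gt0.
have [k1 [m1 [km1 gmax]]] := grid_max N_gt0 K_gt0 (cell_periodic gcell).
have [k2 [m2 [km2 gmin]]] := cell_min.
pose S := [set y : R | exists k m o o', in_grid k m /\ y = `|g k (m + step o) - g k (m + step o')|].
have o0 : 'I_d * bool := (Ordinal d_gt0, false).
have Sub : ubound S (g k1.+1 m1 - g k2.+1 m2).
  move=> _ [k [m [ o [ o' [km ->]]]]].
  have i1 : in_dual_grid k (m + step o) by rewrite in_dual_grid_step.
  have i2 : in_dual_grid k (m + step o') by rewrite in_dual_grid_step.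
  have := gmax _ _ i1; have := gmax _ _ i2; have := gmin _ _ i1; have := gmin _ _ i2.
  by move=> ? ? ? ?; rewrite ler_norml; apply/andP; split; lra.
have S0 : S !=set0.
  by exists `|g k1 (m1 + step o0) - g k1 (m1 + step o0)|, k1, m1, o0, o0; rewrite -in_dual_gridS.
have Sb y : S y -> y <= sup S by apply: ub_le_sup; exists (g k1.+1 m1 - g k2.+1 m2).
have b0 : 0 <= sup S by case: S0 => y Sy; apply: le_trans (Sb y Sy); case: Sy => ? [? [? [? [_ ->]]]].
set b := sup S in Sb b0 *.
have dd : 0 < 2 * d%:R :> R by rewrite mulr_gt0 // ltr0n.
pose b' := b + 4 * mesh N * r.
have hr0 : 0 <= mesh N * r by rewrite mulr_ge0 // ltW.
have b'0 : 0 <= b' by rewrite /b' addr_ge0 // -mulrA mulr_ge0.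
(* One step of the scheme before time k + 1; shifting by a period first makes the
   previous time nonnegative. *)
have contract y : S y -> y <= b' - (2 * d%:R)^-1 * b' + 2 * mesh K * B.
  move=> [k0 [m [ o [ o' [km0 ->]]]]].
  pose k := (k0 + 2 * K - 1)%N.
  have kE : (k0 + 2 * K * 1)%N = k.+1 by rewrite muln1 /k subn1 prednK // addn_gt0 muln_gt0 K_gt0 orbT.
  have lift o1 : g k0 (m + step o1) = g k.+1 (m + step o1).
    rewrite -kE -[m + step o1 in RHS]addr0 -(mul0rn _ (2 * N)) (cell_periodic gcell) //.
    by rewrite in_dual_grid_step.
  rewrite !lift.
  have km : in_grid k.+1 m.
    rewrite -in_dual_gridS -kE -addSn -[m]addr0 -(mul0rn _ (2 * N)) in_dual_grid_translate.
    by rewrite in_dual_gridS.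
  have kS o1 : in_grid k (m + step o1) by rewrite in_grid_step -in_gridS.
  pose F := g k; rewrite !(cell_scheme gcell) // -/F.
  have HP := HB k _ (kS o); have HQ := HB k _ (kS o'); rewrite -/F in HP HQ.
  have two o1 : `|F (m + step o1 + step o1) - F m| <= 2 * (mesh N * r).
    have := Dx_step F (m + step o1) o1 N_gt0; rewrite addrK => /le_trans -> //.
    by rewrite -mulrA ler_pM2l // ler_pM2l // gr.
  have avg : `|average F (m + step o) - average F (m + step o')| <= b' - (2 * d%:R)^-1 * b'.
    rewrite /average -mulrBr normrM ger0_norm ?invr_ge0 ?(ltW dd) //.
    rewrite -[X in _ <= X - _](mulKf (lt0r_neq0 dd) b') -mulrBr ler_pM2l ?invr_gt0 //.
    (* Pair the neighbour o1 of the first point with o1 of the second, except that o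
       and o' are exchanged: the pair at o' is then a common neighbour. *)
    rewrite [X in _ - X](reindex_inj (@perm_inj _ (tperm o o'))) -sumrB.
    apply: (le_trans (ler_norm_sum _ _ _)).
    have term o1 : `|F (m + step o + step o1) - F (m + step o' + step (tperm o o' o1))| <= b'.
      case: tpermP => [->|->|/eqP oo1 /eqP o'o1].
      - apply: (le_trans (ler_distD (F m) _ _)); rewrite (distrC (F m)).
        apply: (le_trans (lerD (two _) (two _))).
        by rewrite /b' -mulrDl -mulrA -[2 + 2]natrD lerDr.
      - by rewrite (addrAC m (step o)) subrr normr0.
      - rewrite (addrAC m (step o)) (addrAC m (step o')).
        apply: (@le_trans _ _ b); last by rewrite lerDl -mulrA mulr_ge0.
        by apply: Sb; exists k, (m + step o1), o, o'.
    rewrite lerBrDr (bigD1 o') //= tpermR (addrAC m (step o)) subrr normr0 add0r.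
    rewrite (_ : 2 * d%:R * b' = \sum_(o1 : 'I_d * bool) b'); last first.
      by rewrite sumr_const card_prod card_ord card_bool mulnC -natrM mulr_natl.
    rewrite [leRHS](bigD1 o') //= [leRHS]addrC lerD2r.
    by apply: ler_sum => o1 _; exact: term.
  move: HP HQ; set HP := hamiltonian _ _ _ _; set HQ := hamiltonian _ _ _ _ => HP_B HQ_B.
  set AP := average _ _ in avg *; set AQ := average _ _ in avg *.
  have -> : AP - mesh K * HP + mesh K * a - (AQ - mesh K * HQ + mesh K * a)
      = AP - AQ - mesh K * (HP - HQ) by ring.
  apply: (le_trans (ler_normB _ _)); apply: lerD avg _.
  rewrite normrM (gtr0_norm t0) (mulrC 2) -mulrA ler_pM2l //.
  apply: (le_trans (ler_normB _ _)).
  rewrite mulr_natl mulr2n.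
  exact: lerD HP_B HQ_B.
have bb : b <= b' - (2 * d%:R)^-1 * b' + 2 * mesh K * B by apply: ge_sup.
have final : b <= 2 * d%:R * (4 * mesh N * r + 2 * mesh K * B).
  rewrite -ler_pdivrMl //.
  have : 0 <= (2 * d%:R)^-1 * (4 * mesh N * r) by rewrite mulr_ge0 ?invr_ge0 ?(ltW dd) // -mulrA mulr_ge0.
  by move: bb; rewrite /b' !mulrDr; lra.
move=> k m o o' km; apply: le_trans final; apply: Sb; by exists k, m, o, o'.
Qed.

End Estimates.
End CellSolution.

(** * Smoothing of discrete subsolutions *)
Section MovingAverage.
Context {R : realType} {d : nat}.
Hypothesis d_gt0 : (0 < d)%N.
Implicit Types (m z : 'rV[int]_d) (N K k l n : nat) (o : 'I_d * bool).
Implicit Types (u : 'rV[int]_d -> R) (g : nat -> 'rV[int]_d -> R).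
Variables (L : 'rV[R]_d * R * 'rV[R]_d -> R) (hL : lagrangian L).

Record regular_subsolution c a N K rho lip g : Prop := RegularSubsolution {
  subsol_periodic : forall k m z l, in_dual_grid k m ->
    g (k + 2 * K * l)%N (m + z *+ (2 * N)) = g k m ;
  subsol_scheme : forall k m, in_grid k m ->
    g k.+1 m <= average (g k) m
      - mesh K * hamiltonian L (xpt N m) (tpt K k) (c + Dx N (g k) m) + mesh K * a ;
  subsol_gradient : forall k m, in_grid k m -> `|c + Dx N (g k) m| <= rho ;
  subsol_neighbour : forall k m o, in_dual_grid k.+1 m ->
    `|g k.+1 m - g k (m + step o)| <= lip }.

(** The mean of g over n + 1 points of a line along which time increases; this
    keeps time nonnegative and stays on the dual grid. *)
Definition moving_average n o g k m : R :=
  n.+1%:R^-1 * \sum_(i < n.+1) g (k + i)%N (m - step o *+ i).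

Lemma average_mean n (F : 'I_n.+1 -> 'rV[int]_d -> R) m :
  average (fun m => n.+1%:R^-1 * \sum_i F i m) m = n.+1%:R^-1 * \sum_i average (F i) m.
Proof.
rewrite /average -mulr_sumr mulrCA exchange_big -mulr_sumr; congr (_ * _).
Qed.

Lemma Dx_mean N n (F : 'I_n.+1 -> 'rV[int]_d -> R) m :
  Dx N (fun m => n.+1%:R^-1 * \sum_i F i m) m = n.+1%:R^-1 *: \sum_i Dx N (F i) m.
Proof.
apply/rowP => j; rewrite !mxE summxE -mulrBr -sumrB -mulrA mulr_suml.
by congr (_ * _); apply: eq_bigr => i _; rewrite mxE.
Qed.

Lemma average_translate u m z : average (fun m => u (m - z)) m = average u (m - z).
Proof.
by rewrite (@eq_average_shift _ _ u _ (m - z) m 0) ?addr0 // => o; rewrite addr0 addrAC.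
Qed.

Lemma Dx_translate N u m z : Dx N (fun m => u (m - z)) m = Dx N u (m - z).
Proof. by apply: (@eq_Dx_shift _ _ _ _ _ _ _ 0) => o; rewrite addr0 addrAC. Qed.

Lemma mean_const n (x : R) : n.+1%:R^-1 * (\sum_(i < n.+1) x) = x.
Proof. by rewrite sumr_const card_ord -[x *+ _]mulr_natl mulKf. Qed.

Lemma mean_le n (F : 'I_n.+1 -> R) B : (forall i, F i <= B) ->
  n.+1%:R^-1 * \sum_i F i <= B.
Proof.
by move=> FB; rewrite -[leRHS](mean_const n) ler_pM2l ?invr_gt0 // ler_sum.
Qed.

Lemma norm_xptB N m z : (0 < N)%N -> `|xpt N (m - z) - xpt N m| = mesh N * `|map_mx intr z : 'rV[R]_d|.
Proof.
move=> N0; have -> : xpt N (m - z) - xpt N m = - (mesh N *: map_mx intr z) :> 'rV[R]_d.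
  by apply/rowP => j; rewrite !mxE intrB; ring.
by rewrite normrN normrZ gtr0_norm // mesh_gt0.
Qed.

Lemma norm_step o : `|map_mx intr (step o) : 'rV[R]_d| <= 1.
Proof.
apply: norm_le_coord => // j; rewrite mxE -intr_norm lerz1.
by rewrite !mxE normrM normrX normrN1 expr1n mul1r; case: (_ && _).
Qed.

Lemma norm_step_muln o i : `|map_mx intr (step o *+ i) : 'rV[R]_d| <= i%:R.
Proof.
elim: i => [|i IH]; first by rewrite mulr0n map_mx0 normr0.
rewrite mulrSr map_mxD -natr1; apply: (le_trans (ler_normD _ _)).
by rewrite lerD // norm_step.
Qed.

(** Averages of subsolutions along a line of the grid are subsolutions, by Jensen's
    inequality, up to the oscillation of H over the length of that line. *)
Lemma moving_average_subsolution c a N K rho lip g n o C :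
  (0 < N)%N -> (0 < K)%N -> 0 <= C ->
  (forall x t p x' t' p', `|p| <= rho -> `|p'| <= rho ->
    hamiltonian L x t p - hamiltonian L x' t' p' <= C * (`|x - x'| + `|t - t'| + `|p - p'|)) ->
  regular_subsolution c a N K rho lip g ->
  regular_subsolution c (a + C * (n%:R * (mesh N + mesh K))) N K rho lip (moving_average n o g).
Proof.
move=> N0 K0 C0 hC gs; have h0 := @mesh_gt0 R N N0; have t0 := @mesh_gt0 R K K0.
have walk_grid k m i : in_grid (k + i) (m - step o *+ i) = in_grid k m.
  by rewrite -in_dual_gridS -addSn in_dual_grid_walk in_dual_gridS.
have gradE k m : c + Dx N (moving_average n o g k) m
    = n.+1%:R^-1 *: \sum_(i < n.+1) (c + Dx N (g (k + i)%N) (m - step o *+ i)).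
  rewrite Dx_mean big_split scalerDr /=; congr (_ + _).
    by rewrite sumr_const card_ord -[c *+ _]scaler_nat scalerA mulVf // scale1r.
  by congr (_ *: _); apply: eq_bigr => i _; rewrite Dx_translate.
have gs_grad k m (i : 'I_n.+1) : in_grid k m -> `|c + Dx N (g (k + i)%N) (m - step o *+ i)| <= rho.
  by move=> km; apply: (subsol_gradient gs); rewrite walk_grid.
have grad k m : in_grid k m -> `|c + Dx N (moving_average n o g k) m| <= rho.
  move=> km; rewrite gradE normrZ ger0_norm ?invr_ge0 //.
  apply: (@le_trans _ _ (n.+1%:R^-1 * \sum_(i < n.+1) `|c + Dx N (g (k + i)%N) (m - step o *+ i)|)).
    by rewrite ler_pM2l ?invr_gt0 // ler_norm_sum.
  by apply: mean_le => i; exact: gs_grad.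
split => // [k m z l km|k m km|k m o' km].
- rewrite /moving_average; congr (_ * _); apply: eq_bigr => i _.
  by rewrite addnAC addrAC (subsol_periodic gs) // in_dual_grid_walk.
- have -> : average (moving_average n o g k) m
      = n.+1%:R^-1 * \sum_(i < n.+1) average (g (k + i)%N) (m - step o *+ i).
    rewrite average_mean; congr (_ * _); apply: eq_bigr => i _.
    by rewrite average_translate.
  pose p (i : 'I_n.+1) := c + Dx N (g (k + i)%N) (m - step o *+ i).
  pose E := C * (n%:R * (mesh N + mesh K)).
  have J : hamiltonian L (xpt N m) (tpt K k) (c + Dx N (moving_average n o g k) m)
      <= n.+1%:R^-1 * \sum_(i < n.+1) hamiltonian L (xpt N m) (tpt K k) (p i).
    by rewrite gradE; exact: hamiltonian_average.
  have T (i : 'I_n.+1) : g (k.+1 + i)%N (m - step o *+ i)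
      <= average (g (k + i)%N) (m - step o *+ i)
        - mesh K * hamiltonian L (xpt N m) (tpt K k) (p i) + mesh K * (a + E).
    rewrite addSn; apply: (le_trans (subsol_scheme gs _)); first by rewrite walk_grid.
    rewrite -/(p i) mulrDr !addrA addrAC lerD2r -addrA lerD2l addrC -lerBlDr opprK addrC.
    rewrite -mulrBr ler_pM2l //.
    apply: (le_trans (hC _ _ _ _ _ _ (gs_grad _ _ _ km) (gs_grad _ _ _ km))).
    rewrite subrr normr0 addr0 ler_wpM2l // mulrDr lerD //.
      rewrite distrC norm_xptB // mulrC ler_pM2r //.
      apply: (le_trans (norm_step_muln _ _)); rewrite ler_nat -ltnS; exact: ltn_ord.
    rewrite /tpt -mulrBr normrM (gtr0_norm t0) mulrC ler_pM2r //.
    rewrite natrD opprD addrA subrr sub0r normrN normr_nat ler_nat -ltnS; exact: ltn_ord.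
  rewrite {1}/moving_average.
  apply: (@le_trans _ _ (n.+1%:R^-1 * \sum_(i < n.+1) (average (g (k + i)%N) (m - step o *+ i)
        - mesh K * hamiltonian L (xpt N m) (tpt K k) (p i) + mesh K * (a + E)))).
    by rewrite ler_pM2l ?invr_gt0 // ler_sum.
  rewrite big_split sumrB /= mulrDr mean_const lerD2r mulrBr lerD2l lerN2.
  by rewrite -mulr_sumr mulrCA ler_pM2l.
- rewrite /moving_average -mulrBr -sumrB normrM ger0_norm ?invr_ge0 //.
  apply: (@le_trans _ _ (n.+1%:R^-1 * \sum_(i < n.+1)
      `|g (k.+1 + i)%N (m - step o *+ i) - g (k + i)%N (m + step o' - step o *+ i)|)).
    by rewrite ler_pM2l ?invr_gt0 // ler_norm_sum.
  apply: mean_le => i; rewrite addSn addrAC; apply: (subsol_neighbour gs).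
  by rewrite in_dual_gridS walk_grid -in_dual_gridS.
Qed.

(** Approximate convexity along the space-time direction (step o, -1). The middle
    point is at time k + 1, so that all three points lie on the dual grid. *)
Definition semiconvex o sigma g : Prop := forall k m, in_dual_grid k.+1 m ->
  2 * g k.+1 m - sigma <= g k (m + step o) + g k.+2 (m - step o).

(** The first difference of a moving average telescopes to a difference of two
    values n + 1 steps apart, divided by n + 1; its second difference is therefore
    a first difference of g divided by n + 1. *)
Lemma moving_average_semiconvex c a N K rho lip g n o :
  regular_subsolution c a N K rho lip g ->
  semiconvex o (n.+1%:R^-1 * (2 * lip)) (moving_average n o g).
Proof.
have walkS m' i : m' + step o - step o *+ i.+1 = m' - step o *+ i.
  by rewrite mulrS opprD addrA addrK.
move=> gs k m km; pose G i := g (k + i)%N (m + step o - step o *+ i).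
have Glip i : `|G i.+1 - G i| <= lip.
  rewrite /G addnS walkS addrAC; apply: (subsol_neighbour gs).
  by rewrite -addSn in_dual_grid_walk.
have -> : moving_average n o g k (m + step o) = n.+1%:R^-1 * \sum_(i < n.+1) G i by [].
have -> : moving_average n o g k.+1 m = n.+1%:R^-1 * \sum_(i < n.+1) G i.+1.
  congr (_ * _); apply: eq_bigr => i _; rewrite /G addSnnS; congr (g _ _).
  by rewrite walkS.
have -> : moving_average n o g k.+2 (m - step o) = n.+1%:R^-1 * \sum_(i < n.+1) G i.+2.
  congr (_ * _); apply: eq_bigr => i _; rewrite /G !addSnnS; congr (g _ _).
  by rewrite walkS mulrS opprD addrA.
rewrite mulrCA -mulrBr -mulrDr ler_pM2l ?invr_gt0 //.
have T (F : nat -> R) : \sum_(i < n.+1) F i.+1 - \sum_(i < n.+1) F i = F n.+1 - F 0%N.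
  by rewrite -sumrB -(big_mkord xpredT (fun i => F i.+1 - F i)) telescope_sumr.
have := T G; have := T (fun i => G i.+1); have := Glip 0%N; have := Glip n.+1.
rewrite !ler_norml => /andP[? ?] /andP[? ?] T1 T2; lra.
Qed.

Lemma moving_average_preserves_semiconvex o' sigma n o g :
  semiconvex o sigma g -> semiconvex o sigma (moving_average n o' g).
Proof.
move=> gsc k m km.
have -> : 2 * moving_average n o' g k.+1 m - sigma
    = n.+1%:R^-1 * \sum_(i < n.+1) (2 * g (k.+1 + i)%N (m - step o' *+ i) - sigma).
  by rewrite sumrB mulrBr mean_const -mulr_sumr mulrCA.
rewrite /moving_average -mulrDr -big_split ler_pM2l ?invr_gt0 //=.
apply: ler_sum => i _; rewrite !addSn (addrAC m (step o)) (addrAC m (- step o)).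
by apply: gsc; rewrite -addSn in_dual_grid_walk.
Qed.

(** Moving averages commute with each other, so averaging once along each of the 2d
    directions makes all the second differences small at the same time. *)
Lemma smoothed_subsolution c a N K rho lip g n C :
  (0 < N)%N -> (0 < K)%N -> 0 <= C ->
  (forall x t p x' t' p', `|p| <= rho -> `|p'| <= rho ->
    hamiltonian L x t p - hamiltonian L x' t' p' <= C * (`|x - x'| + `|t - t'| + `|p - p'|)) ->
  regular_subsolution c a N K rho lip g ->
  exists2 G, regular_subsolution c (a + (2 * d)%:R * (C * (n%:R * (mesh N + mesh K)))) N K rho lip G
    & forall o, semiconvex o (n.+1%:R^-1 * (2 * lip)) G.
Proof.
move=> N0 K0 C0 hC gs.
set e := C * _.
suff iter (s : seq ('I_d * bool)) :
    exists2 G, regular_subsolution c (a + (size s)%:R * e) N K rho lip G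
      & forall o, o \in s -> semiconvex o (n.+1%:R^-1 * (2 * lip)) G.
  have [G Gs Gc] := iter (enum {: 'I_d * bool}).
  exists G => [|o]; last by apply: Gc; rewrite mem_enum.
  by rewrite -cardE card_prod card_ord card_bool mulnC in Gs.
elim: s => [|o s [G Gs Gc]]; first by exists g; rewrite ?mul0r ?addr0.
exists (moving_average n o G) => [|o'].
  by have := moving_average_subsolution n o N0 K0 C0 hC Gs; rewrite -/e -addrA /= -natr1 mulrDl mul1r.
rewrite inE => /orP[/eqP ->|o's]; first exact: moving_average_semiconvex Gs.
exact: moving_average_preserves_semiconvex (Gc _ o's).
Qed.

End MovingAverage.

(** * The two comparison inequalities *)
Section Comparison.
Context {R : realType} {d : nat}.
Hypothesis d_gt0 : (0 < d)%N.
Implicit Types (m z : 'rV[int]_d) (N K k l n : nat) (o : 'I_d * bool).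
Implicit Types (u : 'rV[int]_d -> R) (g : nat -> 'rV[int]_d -> R).

Notation dir o := (map_mx intr (step o) : 'rV[R]_d).

Lemma dot_dir (p : 'rV[R]_d) j b : dot p (dir (j, b)) = (-1) ^+ b * p 0 j.
Proof.
have -> : dir (j, b) = (-1) ^+ b *: ebasis j.
  apply/rowP => i; rewrite !mxE intrM; congr (_ * _); last by case: (_ && _).
  by case: b.
by rewrite dotZr dot_ebasis.
Qed.

Lemma dot_dir_dir o : dot (dir o) (dir o) = 1.
Proof.
case: o => j b; rewrite dot_dir !mxE !eqxx /= mulr1.
by case: b; rewrite /= ?expr0 ?expr1 ?mulN1r ?mul1r ?opprK.
Qed.

Lemma xpt_add N m z : xpt N (m + z) = xpt N m + mesh N *: map_mx intr z :> 'rV[R]_d.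
Proof. by apply/rowP => j; rewrite !mxE intrD mulrDr. Qed.

Lemma tptS K k : tpt K k.+1 = tpt K k + mesh K :> R.
Proof. by rewrite /tpt -natr1 mulrDr mulr1. Qed.

Lemma quad_shift kappa (y Y : 'rV[R]_d) s r x t :
  quad kappa (y + Y) (s + r) (x, t) = quad kappa y s (x, t)
    - dot ((2 * kappa) *: (x - y)) Y - 2 * kappa * (t - s) * r
    + kappa * (dot Y Y + r ^+ 2).
Proof.
rewrite /quad /= (opprD y) (addrA x); move: (x - y) => X.
by rewrite dotBl !dotBr dotZl (dotC Y X); ring.
Qed.

Definition affine N m A p : 'rV[int]_d -> R := fun z => A + dot p (xpt N z - xpt N m).

Lemma affine_step N m A p o : affine N m A p (m + step o) = A + mesh N * dot p (dir o).
Proof. by rewrite /affine xpt_add (addrC (xpt N m)) addrK dotZr. Qed.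

Lemma average_affine N m A p : average (affine N m A p) m = A.
Proof.
rewrite (@eq_average_shift _ _ (affine N m 0 p) _ m m A) // => [|o]; last first.
  by rewrite !affine_step add0r addrC.
rewrite /average; under eq_bigr do rewrite affine_step add0r.
by rewrite -mulr_sumr sum_dot_step !mulr0 add0r.
Qed.

Lemma Dx_affine N m A p : (0 < N)%N -> Dx N (affine N m A p) m = p.
Proof.
move=> N0; have h0 := @mesh_gt0 R N N0.
apply/rowP => j; rewrite mxE !affine_step !dot_dir /= expr0 expr1.
by field; rewrite gt_eqF.
Qed.

Lemma averageB u w m : average (fun z => u z - w z) m = average u m - average w m.
Proof. by rewrite /average -mulrBr -sumrB. Qed.

Lemma DxB N u w m : Dx N (fun z => u z - w z) m = Dx N u m - Dx N w m.
Proof. by apply/rowP => j; rewrite !mxE -mulrBl; congr (_ / _); ring. Qed.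

(** Monotonicity of the scheme: the difference of the two sides is the sum of the
    values of u at the neighbours m + omega with the weights
    (2d)^-1 - (tau / 2h) zeta.omega of the random walk of velocity zeta, and these
    weights are nonnegative for velocities below h / (d tau). *)
Lemma upwind_positivity N K M (zeta : 'rV[R]_d) u m : (0 < N)%N -> (0 < K)%N ->
  d%:R * M * mesh K <= mesh N -> `|zeta| <= M ->
  (forall o, 0 <= u (m + step o)) -> mesh K * dot (Dx N u m) zeta <= average u m.
Proof.
move=> N0 K0 cfl zM u0; have h0 := @mesh_gt0 R N N0; have t0 := @mesh_gt0 R K K0.
pose S := \sum_(o : 'I_d * bool) u (m + step o).
have S0 : 0 <= S by apply: sumr_ge0.
have d0 : 0 < d%:R :> R by rewrite ltr0n.
have D : dot (Dx N u m) zeta <= M / (2 * mesh N) * S.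
  rewrite /S -(pair_bigA _ (fun j b => u (m + step (j, b)))) mulr_sumr.
  apply: ler_sum => j _; rewrite big_bool /= mxE mulrAC [leRHS]mulrAC.
  rewrite ler_pM2r ?invr_gt0 ?mulr_gt0 //.
  have := le_trans (coord_le_norm zeta j) zM; rewrite ler_norml => /andP[z1 z2].
  have z3 : 0 <= M - zeta 0 j by lra.
  have z4 : 0 <= M + zeta 0 j by lra.
  have := mulr_ge0 (u0 (j, false)) z3; have := mulr_ge0 (u0 (j, true)) z4; lra.
rewrite /average -/S -(ler_pM2l (_ : 0 < 2 * d%:R)) ?mulr_gt0 // mulVKf ?mulf_neq0 ?gt_eqF //.
apply: (@le_trans _ _ (2 * d%:R * (mesh K * (M / (2 * mesh N) * S)))).
  by rewrite !ler_pM2l ?mulr_gt0.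
rewrite (_ : _ * _ = (d%:R * M * mesh K) / mesh N * S); last by field; rewrite gt_eqF.
by rewrite ler_piMl // ler_pdivrMr // mul1r.
Qed.

Variables (L : 'rV[R]_d * R * 'rV[R]_d -> R) (hL : lagrangian L).
Variables (N K : nat) (lambda0 lambda1 s : R).
Hypotheses (N_gt0 : (0 < N)%N) (K_gt0 : (0 < K)%N).
Hypotheses (lambda0_gt0 : 0 < lambda0) (lambda1_gt0 : 0 < lambda1).
Hypotheses (tau_ge : lambda0 * mesh N <= mesh K) (tau_le : mesh K <= lambda1 * mesh N).
Hypotheses (s_gt0 : 0 < s) (s_le1 : s <= 1) (s_sqr : s ^+ 2 = mesh N).

Let h_gt0 : 0 < mesh N :> R := mesh_gt0 N_gt0.
Let tau_gt0 : 0 < mesh K :> R := mesh_gt0 K_gt0.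

Lemma tau_le_s : mesh K <= lambda1 * s.
Proof.
apply: (le_trans tau_le); rewrite ler_pM2l // -s_sqr expr2.
by rewrite ler_piMl // ltW.
Qed.

(** The slope of the penalty |x|^2 / s determines the gap x; bounded slopes mean
    gaps of order s. *)
Lemma norm_slope (V : normedModType R) (x : V) : `|x| = s / 2 * `|(2 * s^-1) *: x|.
Proof.
have s20 : 0 < 2 * s^-1 by rewrite mulr_gt0 ?invr_gt0.
rewrite normrZ gtr0_norm //; field; exact: lt0r_neq0.
Qed.

(** Doubling with v as the subsolution. At a maximum of v - g minus the penalty, g
    lies above an affine function of gradient p up to the curvature h^2 / s of the
    penalty. The convexity inequality for H at the discrete gradient, where the
    subgradient zeta of H is a velocity of the scheme, and the monotonicity of the
    random walk with velocity zeta turn this into the discrete supersolution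
    inequality with the gradient p in place of the discrete gradient. The slope p is bounded by moving the grid point
    by two steps, and the time slope q by the two inequalities themselves. *)
Lemma discrete_le_viscosity c a b M g v gamma r B C :
  cell_solution L c a N K M g -> viscosity_solution L c b v ->
  d%:R * M * mesh K <= mesh N ->
  (forall k m, in_grid k m -> `|Dx N (g k) m| <= r) ->
  `|c| <= gamma -> 0 <= r -> 0 <= C -> `|a| <= B -> `|b| <= B ->
  (forall x t p, `|p| <= gamma + r + 2 -> `|hamiltonian L x t p| <= B) ->
  (forall x t p x' t' p', `|p| <= gamma + r + 2 -> `|p'| <= gamma + r + 2 ->
    hamiltonian L x t p - hamiltonian L x' t' p' <= C * (`|x - x'| + `|t - t'| + `|p - p'|)) ->
  a <= b + s * (lambda1 + lambda0^-1
    + C * ((r + 2) / 2 + (2 * B + lambda1 + lambda0^-1) / 2 + lambda1)).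
Proof.
move=> gcell hv cfl gr cgamma r0 C0 aB bB HB HC.
pose kappa := s^-1; have kappa0 : 0 < kappa by rewrite invr_gt0.
have [|x [t [k [m [km vmax]]]]] := doubling_max (g := fun k m => - g k m) N_gt0 K_gt0
    (viscosity_continuous hv) (viscosity_periodic hv) kappa0.
  by move=> k m z l km; rewrite (cell_periodic gcell).
have kmg : in_grid k m by rewrite -in_dual_gridS.
have [p pE] : exists p, p = (2 * kappa) *: (x - xpt N m) by eexists.
pose q := 2 * kappa * (t - tpt K k.+1).
have I1 : q + hamiltonian L x t (c + p) <= b.
  rewrite pE; apply: (viscosity_sub_quad hv) => -[x' t'].
  by have := vmax x' t' _ _ km; lra.
have kh : kappa * mesh N = s by rewrite -s_sqr /kappa expr2 mulKf // gt_eqF.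
(* The competitor is the grid point two steps away in direction o. *)
have p_le o : dot p (dir o) <= r + 2.
  have dual2 : in_dual_grid k.+1 (m + step o + step o) by rewrite in_dual_grid_step in_grid_step.
  have := vmax x t _ _ dual2; rewrite (_ : xpt N (_ + step o) = xpt N m + (2 * mesh N) *: dir o); last first.
    by rewrite -addrA xpt_add map_mxD scalerDr -scalerDl mulr_natl mulr2n.
  rewrite -{1}[tpt K k.+1]addr0 quad_shift -pE !dotZr !dotZl dot_dir_dir => I.
  have := Dx_step (g k.+1) (m + step o) o N_gt0; rewrite addrK => J.
  have := gr k.+1 (m + step o); rewrite in_grid_step => /(_ km) J'.
  have {}J := le_trans J (ler_wpM2l (mulr_ge0 (ler0n _ 2) (ltW h_gt0)) J').
  move: J; rewrite ler_norml => /andP[_ J].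
  have I' : mesh N * dot p (dir o) <= mesh N * (r + 2 * (kappa * mesh N)) by lra.
  rewrite ler_pM2l // kh in I'.
  by apply: (le_trans I'); rewrite lerD2l ler_piMr.
have p_norm : `|p| <= r + 2.
  apply: norm_le_coord => [|j]; first by rewrite addr_ge0.
  have := p_le (j, true); have := p_le (j, false); rewrite !dot_dir /= expr0 expr1 mul1r mulN1r.
  by move=> ? ?; rewrite ler_norml; apply/andP; split; lra.
(* E is g minus its affine minorant; the last term of A is the curvature of the
   penalty over one step. *)
pose A := g k.+1 m - mesh K * q - kappa * (mesh K ^+ 2 + mesh N ^+ 2).
pose E z := g k z - affine N m A p z.
have E0 o : 0 <= E (m + step o).
  have dual1 : in_dual_grid k (m + step o) by rewrite in_dual_grid_step.
  have := vmax x t _ _ dual1; rewrite xpt_add.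
  rewrite (_ : tpt K k = tpt K k.+1 + - mesh K); last by rewrite tptS addrK.
  rewrite quad_shift -pE -/q !dotZr !dotZl dot_dir_dir /E affine_step /A; lra.
pose Dg := Dx N (g k) m; pose zeta := hamiltonian_p L (xpt N m) (tpt K k) (c + Dg).
have zmax : maximizes L (xpt N m) (tpt K k) (c + Dg) zeta.
  have [z zmax] := maximizer hL (xpt N m) (tpt K k) (c + Dg).
  by rewrite /zeta (hamiltonian_p_maximizes hL zmax).
have := upwind_positivity N_gt0 K_gt0 cfl (cell_speed gcell kmg) E0.
rewrite -/Dg -/zeta averageB average_affine DxB Dx_affine // -/Dg => up.
have := cell_scheme gcell kmg; rewrite -/Dg (hamiltonian_maximizes zmax) => sch.
have := hamiltonian_ge hL (xpt N m) (tpt K k) (c + p) zeta.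
rewrite -(ler_pM2l tau_gt0) => cvx.
set Hm := hamiltonian L (xpt N m) (tpt K k) (c + p) in cvx.
rewrite !dotDl in sch cvx; rewrite dotBl in up.
have I2' : mesh K * a <= mesh K * (q + Hm) + kappa * (mesh K ^+ 2 + mesh N ^+ 2).
  by move: up sch cvx; rewrite /A; lra.
have e_le : kappa * (mesh K ^+ 2 + mesh N ^+ 2) <= mesh K * (s * (lambda1 + lambda0^-1)).
  rewrite mulrDr mulrDr mulrDr; apply: lerD.
    rewrite expr2 mulrCA ler_pM2l //; apply: (@le_trans _ _ (kappa * (lambda1 * mesh N))).
      by rewrite ler_pM2l.
    by rewrite mulrCA kh mulrC.
  by rewrite expr2 [leLHS]mulrA kh [leRHS]mulrCA ler_pM2l // ler_pdivlMr // mulrC.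
have I2 : a <= q + Hm + s * (lambda1 + lambda0^-1).
  rewrite -(ler_pM2l tau_gt0) [leRHS]mulrDr; exact: le_trans I2' (lerD (lexx _) e_le).
have cp : `|c + p| <= gamma + r + 2.
  by apply: (le_trans (ler_normD _ _)); rewrite -addrA lerD.
have HB1 := HB x t _ cp; have HB2 := HB (xpt N m) (tpt K k) _ cp; rewrite -/Hm in HB2.
have lam0 : 0 <= lambda1 + lambda0^-1 by rewrite ltW // addr_gt0 // invr_gt0.
have slam : s * (lambda1 + lambda0^-1) <= lambda1 + lambda0^-1 by rewrite ler_piMl.
have q_norm : `|q| <= 2 * B + lambda1 + lambda0^-1.
  move: aB bB HB1 HB2; rewrite !ler_norml => /andP[? ?] /andP[? ?] /andP[? ?] /andP[? ?].
  by apply/andP; split; lra.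
have := HC (xpt N m) (tpt K k) _ x t _ cp cp; rewrite -/Hm subrr normr0 addr0 => HL.
have gx : `|xpt N m - x| <= s * ((r + 2) / 2).
  rewrite distrC norm_slope -/kappa -pE mulrAC [leRHS]mulrA ler_pM2r ?invr_gt0 //.
  by rewrite ler_pM2l.
have gt : `|tpt K k - t| <= s * ((2 * B + lambda1 + lambda0^-1) / 2) + lambda1 * s.
  rewrite (_ : tpt K k - t = - (t - tpt K k.+1) - mesh K); last by rewrite tptS; ring.
  apply: (le_trans (ler_normB _ _)); apply: lerD; last by rewrite gtr0_norm // tau_le_s.
  rewrite normrN (@norm_slope R^o (t - tpt K k.+1)) [_ *: _]/(_ * _) -/kappa -/q.
  by rewrite mulrAC [leRHS]mulrA ler_pM2r ?invr_gt0 // ler_pM2l.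
have := ler_wpM2l C0 (lerD gx gt); lra.
Qed.


(** Doubling with v as the supersolution. At a maximum of g - v minus the penalty,
    the penalty bounds g from above by an affine function of gradient p at the
    neighbours, and approximate convexity of g bounds it from below, so that the
    discrete gradient is p up to a term of order s and the discrete inequality can be
    compared with the viscosity inequality through the Lipschitz bound for H. *)
Lemma viscosity_le_discrete c a b g v gamma rho lip sigma Sig B1 B C :
  regular_subsolution L c a N K rho lip g -> (forall o, semiconvex o sigma g) ->
  viscosity_solution L c b v ->
  0 <= sigma -> sigma <= Sig * (s * mesh N) ->
  `|c| <= gamma -> 0 <= C -> 0 <= B1 -> a <= B1 -> `|b| <= B ->
  let W := lambda1 ^+ 2 + 1 + Sig in
  (forall x t p, `|p| <= rho + W -> `|hamiltonian L x t p| <= B) ->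
  (forall x t p x' t' p', `|p| <= rho + W -> `|p'| <= rho + W ->
    hamiltonian L x t p - hamiltonian L x' t' p' <= C * (`|x - x'| + `|t - t'| + `|p - p'|)) ->
  b <= a + s * (W / lambda0 + C * ((rho + W + gamma) / 2
    + ((2 * B + B1 + W / lambda0) / 2 + lambda1) + W)).
Proof.
move=> gs gsc hv sigma0 sigma_le cgamma C0 B10 aB1 bB W HB HC.
pose kappa := s^-1; have kappa0 : 0 < kappa by rewrite invr_gt0.
have [x [t [k [m [km vmax]]]]] := doubling_max N_gt0 K_gt0
    (continuous_opp (viscosity_continuous hv)) (periodic_opp (viscosity_periodic hv)) kappa0
    (subsol_periodic gs).
have kmg : in_grid k m by rewrite -in_dual_gridS.
have [p pE] : exists p, p = - ((2 * kappa) *: (x - xpt N m)) by eexists.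
have pE' : (2 * kappa) *: (x - xpt N m) = - p by rewrite pE opprK.
have [q qE] : exists q, q = - (2 * kappa * (t - tpt K k.+1)) by eexists.
have qE' : 2 * kappa * (t - tpt K k.+1) = - q by rewrite qE opprK.
have I1 : b <= q + hamiltonian L x t (c + p).
  have := @viscosity_super_quad _ _ L c b v hv (- kappa) (xpt N m) (tpt K k.+1) x t.
  rewrite mulrN mulNr scaleNr -qE -pE; apply => -[x' t'].
  have := vmax x' t' _ _ km; rewrite /quad !mulNr; lra.
have kh : kappa * mesh N = s by rewrite -s_sqr /kappa expr2 mulKf // gt_eqF.
pose A := g k.+1 m - mesh K * q.
pose kap := kappa * (mesh K ^+ 2 + mesh N ^+ 2) + sigma.
have dotN_ Y : dot (- p) Y = - dot p Y by rewrite -scaleN1r dotZl mulN1r.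
have up o : g k (m + step o) <= A + mesh N * dot p (dir o)
    + kappa * (mesh K ^+ 2 + mesh N ^+ 2).
  have dual1 : in_dual_grid k (m + step o) by rewrite in_dual_grid_step.
  have := vmax x t _ _ dual1; rewrite xpt_add.
  rewrite (_ : tpt K k = tpt K k.+1 + - mesh K); last by rewrite tptS addrK.
  rewrite quad_shift pE' qE' dotN_ !dotZr !dotZl dot_dir_dir /A; lra.
have up' o : g k.+2 (m - step o) <= g k.+1 m + mesh K * q - mesh N * dot p (dir o)
    + kappa * (mesh K ^+ 2 + mesh N ^+ 2).
  have dual2 : in_dual_grid k.+2 (m - step o) by rewrite in_dual_gridS in_grid_stepN.
  have := vmax x t _ _ dual2; rewrite xpt_add map_mxN scalerN -scaleNr tptS.
  rewrite quad_shift pE' qE' dotN_ !dotZr !dotZl dot_dir_dir; lra.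
pose E z := g k z - affine N m A p z.
have E_le o : `|E (m + step o)| <= kap.
  have := gsc o k m km; have := up o; have := up' o.
  rewrite /E affine_step /kap /A ler_norml => ? ? ?; apply/andP; split; lra.
pose Dg := Dx N (g k) m.
have kap0 : 0 <= kap by rewrite addr_ge0 // mulr_ge0 ?(ltW kappa0) // addr_ge0 // sqr_ge0.
have avgE : average (g k) m <= A + kap.
  rewrite -[A in A + _](average_affine N m A p) -lerBlDl -averageB.
  apply: average_le => // o; exact: le_trans (ler_norm _) (E_le o).
have DgE : `|p - Dg| <= kap / mesh N.
  rewrite -(Dx_affine m A p N_gt0) distrC -DxB.
  apply: norm_le_coord => [|j]; first by rewrite divr_ge0 // ltW.
  rewrite mxE normrM normfV (gtr0_norm (_ : 0 < 2 * mesh N)) ?mulr_gt0 //.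
  rewrite ler_pdivrMr ?mulr_gt0 // mulrCA divfK ?gt_eqF // mulr_natl mulr2n.
  exact: le_trans (ler_normB _ _) (lerD (E_le _) (E_le _)).
have kap_le : kap <= W * (s * mesh N).
  rewrite /kap /W mulrDl; apply: lerD => //; rewrite mulrDr mulrDl mul1r; apply: lerD.
    have -> : lambda1 ^+ 2 * (s * mesh N) = kappa * (lambda1 * mesh N) ^+ 2.
      by rewrite -{1}kh; ring.
    by rewrite ler_pM2l // lerXn2r ?nnegrE ?mulr_ge0 // ltW.
  by rewrite expr2 mulrA kh.
have W0 : 0 <= W by rewrite -(pmulr_lge0 _ (mulr_gt0 s_gt0 h_gt0)) (le_trans kap0).
have kap_h : kap / mesh N <= W * s by rewrite ler_pdivrMr // -mulrA.
have kap_tau : kap / mesh K <= W / lambda0 * s.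
  rewrite ler_pdivrMr // (le_trans kap_le) // -!mulrA ler_wpM2l //.
  by rewrite mulrCA ler_pM2l // mulrC ler_pdivlMr // mulrC.
have Ws : W * s <= W by rewrite ler_piMr.
have sch := subsol_scheme gs kmg; rewrite -/Dg in sch.
have I2 : q + hamiltonian L (xpt N m) (tpt K k) (c + Dg) <= a + kap / mesh K.
  have e : mesh K * (kap / mesh K) = kap by rewrite mulrC divfK // gt_eqF.
  rewrite -(ler_pM2l tau_gt0) !mulrDr e; move: sch avgE; rewrite /A; lra.
have grad : `|c + Dg| <= rho := subsol_gradient gs kmg.
have cDg : `|c + Dg| <= rho + W by apply: le_trans grad _; rewrite lerDl.
have cp : `|c + p| <= rho + W.
  rewrite (_ : c + p = (c + Dg) + (p - Dg)); last by rewrite addrACA subrr addr0.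
  apply: (le_trans (ler_normD _ _)); apply: lerD => //.
  exact: le_trans DgE (le_trans kap_h Ws).
have p_norm : `|p| <= rho + W + gamma.
  rewrite (_ : p = c + p - c); last by rewrite addrAC subrr add0r.
  by apply: (le_trans (ler_normB _ _)); apply: lerD.
have HB1 := HB x t _ cp; have HB2 := HB (xpt N m) (tpt K k) _ cDg.
have Wl : W / lambda0 * s <= W / lambda0 by rewrite ler_piMr // divr_ge0 // ltW.
have q_norm : `|q| <= 2 * B + B1 + W / lambda0.
  have Wl0 : 0 <= W / lambda0 by rewrite divr_ge0 // ltW.
  move: bB HB1 HB2; rewrite !ler_norml => /andP[? ?] /andP[? ?] /andP[? ?].
  by apply/andP; split; lra.
have HL := HC x t _ (xpt N m) (tpt K k) _ cp cDg.
have gx : `|x - xpt N m| <= s * ((rho + W + gamma) / 2).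
  rewrite norm_slope -/kappa pE' normrN mulrAC [leRHS]mulrA ler_pM2r ?invr_gt0 //.
  by rewrite ler_pM2l.
have gt : `|t - tpt K k| <= s * ((2 * B + B1 + W / lambda0) / 2) + lambda1 * s.
  rewrite (_ : t - tpt K k = (t - tpt K k.+1) + mesh K); last by rewrite tptS; ring.
  apply: (le_trans (ler_normD _ _)); apply: lerD; last by rewrite gtr0_norm // tau_le_s.
  have qS : (2 * s^-1) *: (t - tpt K k.+1 : R^o) = - q := qE'.
  rewrite (@norm_slope R^o (t - tpt K k.+1)) qS normrN.
  by rewrite mulrAC [leRHS]mulrA ler_pM2r ?invr_gt0 // ler_pM2l.
have gp := le_trans DgE kap_h.
have cpE : (c + p) - (c + Dg) = p - Dg by rewrite opprD addrACA subrr add0r.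
rewrite cpE in HL.
have := ler_wpM2l C0 (lerD (lerD gx gt) gp); lra.
Qed.

End Comparison.

(** * The rate of convergence *)
(** The scheme moves g by O(tau) away from the average over neighbours, and the
    neighbours are within O(h) of each other. *)
Lemma cell_solution_regular (R : realType) (d : nat) (d_gt0 : (0 < d)%N)
    (L : 'rV[R]_d * R * 'rV[R]_d -> R) c a N K M
    (g : nat -> 'rV[int]_d -> R) rho r lambda1 B :
  (0 < N)%N -> (0 < K)%N -> cell_solution L c a N K M g ->
  mesh K <= lambda1 * mesh N -> 0 <= B -> 0 <= r ->
  (forall k m, in_grid k m ->
    `|hamiltonian L (xpt N m) (tpt K k) (c + Dx N (g k) m)| <= B) ->
  (forall k m, in_grid k m -> `|Dx N (g k) m| <= r) ->
  (forall k m, in_grid k m -> `|c + Dx N (g k) m| <= rho) ->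
  regular_subsolution L c a N K rho
    ((2 * d%:R * (4 * r + 2 * lambda1 * B) + 2 * lambda1 * B) * mesh N) g.
Proof.
move=> N0 K0 gcell tau_le B0 r0 HB Dr Drho.
have t0 := @mesh_gt0 R K K0; have h0 := @mesh_gt0 R N N0.
split => //; [exact: (cell_periodic gcell)|by move=> k m km; rewrite (cell_scheme gcell km)|].
move=> k m o km; have kmg : in_grid k m by rewrite -in_dual_gridS.
have aB := cell_value_bounded d_gt0 N0 K0 gcell HB.
have nb := cell_neighbours d_gt0 N0 K0 gcell B0 r0 HB Dr.
set D := 2 * d%:R * (4 * mesh N * r + 2 * mesh K * B) in nb.
have tB : mesh K * B <= lambda1 * mesh N * B by rewrite ler_wpM2r.
have D_le : D <= 2 * d%:R * (4 * r + 2 * lambda1 * B) * mesh N.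
  by rewrite /D -[leRHS]mulrA ler_wpM2l ?mulr_ge0 //; lra.
have avg : `|average (g k) m - g k (m + step o)| <= D.
  rewrite ler_norml; apply/andP; split.
    rewrite lerBrDl; apply: average_ge => // o'.
    by have := nb k m o' o kmg; rewrite ler_norml => /andP[]; lra.
  rewrite lerBlDl; apply: average_le => // o'.
  by have := nb k m o' o kmg; rewrite ler_norml => /andP[]; lra.
rewrite (cell_scheme gcell kmg).
have := HB k m kmg; set H := hamiltonian _ _ _ _ => HH.
rewrite (_ : _ - _ = (average (g k) m - g k (m + step o)) + mesh K * (a - H)); last by ring.
apply: (le_trans (ler_normD _ _)); rewrite mulrDl; apply: lerD; first exact: le_trans avg D_le.
rewrite normrM gtr0_norm //.
apply: (@le_trans _ _ (mesh K * (B + B))); last by lra.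
rewrite ler_pM2l //; exact: le_trans (ler_normB _ _) (lerD aB HH).
Qed.

Unset Implicit Arguments.
Set Strict Implicit.

Theorem theorem3p9 (R : realType) (d : nat) (d_gt0 : (0 < d)%N)
  (L : 'rV[R]_d * R * 'rV[R]_d -> R) (P : set 'rV[R]_d)
  (r lambda0 lambda1 : R) (Hbar : 'rV[R]_d -> R)
  (L_lagrangian : lagrangian L)
  (P_compact : compact P)
  (P_convex : convex_set P)
  (r_gt0 : 0 < r) (lambda0_gt0 : 0 < lambda0) (lambda01 : lambda0 < lambda1)
  (L_standing : exists2 h0 : R, 0 < h0 & forall N K : nat,
     admissible lambda0 lambda1 N K -> mesh N < h0 ->
     standing P r lambda1 L N K)
  (Hbar_effective : forall c, P c -> is_effective_hamiltonian L c (Hbar c)) :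
  exists2 b1 : R, 0 < b1 &
  exists2 h1 : R, 0 < h1 & forall N K : nat,
    admissible lambda0 lambda1 N K -> mesh N < h1 ->
    forall Hdelta : 'rV[R]_d -> R,
      (forall c, P c ->
         is_discrete_effective_hamiltonian r L N K c (Hdelta c)) ->
      (ereal_sup [set `|Hdelta c - Hbar c|%:E | c in P]
         <= (b1 * Num.sqrt (mesh N))%:E)%E.
Proof.
have lambda1_gt0 := lt_trans lambda0_gt0 lambda01.
have d0 : 0 < d%:R :> R by rewrite ltr0n.
pose M := (d%:R * lambda1)^-1.
have [rho rho0 momentum] := maximizes_momentum_bounded L_lagrangian M.
have [gamma gamma0 cgamma] : exists2 gamma, 0 <= gamma & forall c, P c -> `|c| <= gamma.
  have [y [_ yP]] := compact_bounded P_compact; exists (`|y| + 1); first by rewrite addr_ge0.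
  by move=> c Pc; apply: yP => //; rewrite ltr_pwDr // ler_norm.
pose rD := rho + gamma; have rD0 : 0 <= rD by rewrite addr_ge0.
have [BA BA0 HBA] := hamiltonian_bounded L_lagrangian (gamma + rD + 2).
have [CA CA0 HCA] := hamiltonian_lipschitz L_lagrangian (gamma + rD + 2).
pose Lip := 2 * d%:R * (4 * rD + 2 * lambda1 * BA) + 2 * lambda1 * BA.
have Lip0 : 0 <= Lip.
  by rewrite !(addr_ge0, mulr_ge0) // ltW.
pose W := lambda1 ^+ 2 + 1 + 2 * Lip.
have [BB BB0 HBB] := hamiltonian_bounded L_lagrangian (rho + W).
have [CB CB0 HCB] := hamiltonian_lipschitz L_lagrangian (rho + W).
pose E1 := (2 * d)%:R * (CA * (1 + lambda1)).
have E10 : 0 <= E1 by rewrite !mulr_ge0 // addr_ge0 // ltW.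
pose K1 := lambda1 + lambda0^-1
    + CA * ((rD + 2) / 2 + (2 * BA + lambda1 + lambda0^-1) / 2 + lambda1).
pose K2 := W / lambda0 + CB * ((rho + W + gamma) / 2
    + ((2 * (BA + BB) + (BA + E1) + W / lambda0) / 2 + lambda1) + W).
have [h0 h0_gt0 st] := L_standing.
exists (`|K1| + (E1 + `|K2|) + 1); first by rewrite ltr_wpDl // !addr_ge0.
exists (Num.min h0 1) => [|N K adm]; first by rewrite lt_min h0_gt0 ltr01.
rewrite lt_min => /andP[hh0 hlt1] Hdelta Hdelta_eff.
have [N0 K0 /andP[ratio_ge ratio_lt]] := adm.
have h_gt0 := @mesh_gt0 R N N0; have tau_gt0 := @mesh_gt0 R K K0.
have tau_ge : lambda0 * mesh N <= mesh K by rewrite -ler_pdivlMr.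
have tau_le : mesh K <= lambda1 * mesh N by rewrite -ler_pdivrMr // ltW.
set s := Num.sqrt (mesh N).
have s_gt0 : 0 < s by rewrite sqrtr_gt0.
have s_sqr : s ^+ 2 = mesh N by rewrite sqr_sqrtr // ltW.
have s_le1 : s <= 1 by rewrite -sqrtr1 ler_wsqrtr // ltW.
apply: ge_ereal_sup => _ [c Pc <-]; rewrite lee_fin.
set a := Hdelta c; set b := Hbar c.
have [v hv] : exists v, viscosity_solution L c b v.
  by have : [set Hbar c] b by []; rewrite -(Hbar_effective c Pc).
have [w wX wfix] : exists2 w, X r N w & forall m, odd_pt m ->
    solmap L N K c w (2 * K)%N m + a = w m.
  by have : [set Hdelta c] a by []; rewrite -(Hdelta_eff c Pc).
have gcell := cell_solution_solmap d_gt0 L_lagrangian N0 K0 (st N K adm hh0) Pc wX wfix.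
set g := fun k m => _ in gcell.
have cg := cgamma c Pc.
have grad k m : in_grid k m -> `|c + Dx N (g k) m| <= rho.
  move=> km; have := cell_speed gcell km.
  have [zeta zmax] := maximizer L_lagrangian (xpt N m) (tpt K k) (c + Dx N (g k) m).
  rewrite (hamiltonian_p_maximizes L_lagrangian zmax); exact: momentum zmax.
have gradD k m : in_grid k m -> `|Dx N (g k) m| <= rD.
  move=> km; rewrite (_ : Dx N (g k) m = (c + Dx N (g k) m) - c); last by rewrite addrAC subrr add0r.
  by apply: (le_trans (ler_normB _ _)); rewrite lerD // grad.
have rhoA : rho <= gamma + rD + 2 by rewrite /rD; lra.
have gHB k m : in_grid k m -> `|hamiltonian L (xpt N m) (tpt K k) (c + Dx N (g k) m)| <= BA.
  by move=> km; apply: HBA; exact: le_trans (grad k m km) rhoA.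
have aB := cell_value_bounded d_gt0 N0 K0 gcell gHB.
have bB : `|b| <= BA.
  by apply: (viscosity_value_bounded hv) => x t; apply: HBA; apply: (le_trans cg); lra.
have cfl : d%:R * M * mesh K <= mesh N.
  by rewrite /M invfM mulVKf ?gt_eqF // mulrC ler_pdivrMr // mulrC.
have upper := discrete_le_viscosity d_gt0 L_lagrangian N0 K0 lambda0_gt0 lambda1_gt0 tau_ge
  tau_le s_gt0 s_le1 s_sqr gcell hv cfl gradD cg rD0 CA0 aB bB HBA HCA.
have gs := cell_solution_regular d_gt0 N0 K0 gcell tau_le BA0 rD0 gHB gradD grad.
(* Averaging over lines of n steps with n of order h^(-1/2) balances the oscillation
   of H over a length n h against the second differences of order h / n. *)
pose n := Num.truncn s^-1.
have HCA' x t p x' t' p' : `|p| <= rho -> `|p'| <= rho ->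
    hamiltonian L x t p - hamiltonian L x' t' p' <= CA * (`|x - x'| + `|t - t'| + `|p - p'|).
  by move=> pr p'r; apply: HCA; exact: le_trans rhoA.
have [G Gs Gsc] := smoothed_subsolution d_gt0 L_lagrangian n N0 K0 CA0 HCA' gs.
have /andP[n_le n_gt] : n%:R <= s^-1 < n.+1%:R.
  by apply: truncn_itv; rewrite invr_ge0 ltW.
set a' := a + _ in Gs.
have nh : n%:R * (mesh N + mesh K) <= (1 + lambda1) * s.
  have n1 : n%:R * mesh N <= s.
    apply: (le_trans (ler_wpM2r (ltW h_gt0) n_le)).
    by rewrite -s_sqr expr2 mulKf // gt_eqF.
  have n2 := ler_wpM2l (ler0n R n) tau_le.
  rewrite mulrDr mulrDl mul1r lerD // (le_trans n2) // mulrCA ler_pM2l //.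
have a'_le : a' <= a + E1 * s.
  by rewrite lerD2l /E1 -!mulrA ler_wpM2l // ler_wpM2l.
have a'B : a' <= BA + E1.
  apply: (le_trans a'_le); apply: lerD; first exact: le_trans (ler_norm _) aB.
  by rewrite ler_piMr.
have sig0 : 0 <= n.+1%:R^-1 * (2 * (Lip * mesh N)).
  by rewrite mulr_ge0 ?invr_ge0 // mulr_ge0 // mulr_ge0 // ltW.
have sig_le : n.+1%:R^-1 * (2 * (Lip * mesh N)) <= 2 * Lip * (s * mesh N).
  rewrite (_ : 2 * Lip * (s * mesh N) = s * (2 * (Lip * mesh N))); last by ring.
  rewrite ler_wpM2r ?mulr_ge0 // ?ltW //.
  by rewrite invf_plt // ?posrE.
have bB' : `|b| <= BA + BB by apply: (le_trans bB); rewrite lerDl.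
have HBB' x t p : `|p| <= rho + W -> `|hamiltonian L x t p| <= BA + BB.
  by move=> pW; apply: (le_trans (HBB _ _ _ pW)); rewrite lerDr.
have lower := @viscosity_le_discrete R d d_gt0 L N K lambda0 lambda1 s N0 K0
  lambda0_gt0 lambda1_gt0 tau_ge tau_le s_gt0 s_le1 s_sqr
  c a' b G v gamma rho _ _ (2 * Lip) (BA + E1) (BA + BB) CB
  Gs Gsc hv sig0 sig_le cg CB0 (addr_ge0 BA0 E10) a'B bB' HBB' HCB.
rewrite -/W -/K2 in lower; rewrite -/K1 in upper.
have k1 : s * K1 <= s * `|K1| by rewrite ler_pM2l // ler_norm.
have k2 : s * K2 <= s * `|K2| by rewrite ler_pM2l // ler_norm.
have k3 : 0 <= s * `|K1| by rewrite mulr_ge0 // ltW.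
have k4 : 0 <= s * `|K2| by rewrite mulr_ge0 // ltW.
have k5 : 0 <= E1 * s by rewrite mulr_ge0 // ltW.
by rewrite ler_norml; apply/andP; split; lra.
Qed.
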